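(* (a) If $S$ is a B-stable (respectively BI-stable) proper subset of $\mathbb{Z}^2$, then every subset of $S$ is B-stable (respectively BI-stable). (b) If $S$ is an I-stable subset of $\mathbb{Z}^2$ that is not the image under a unimodular transformation of $J_{1/4}$, $J_{1/2}$, or $\mathbb{Z}^2$, then every subset of $S$ is I-stable. (c) Every B-stable (respectively I-stable, BI-stable) proper subset of $\mathbb{Z}^2$ is contained in a maximal B-stable (respectively I-stable, BI-stable) set. (d) There exist non-periodic maximal B-stable sets, non-periodic maximal I-stable sets, and non-periodic maximal BI-stable sets.
   Context: A lattice triangle is the convex hull in $\mathbb{R}^2$ of three non-collinear points of $\mathbb{Z}^2$. A triangle is a set $T = \Delta \cap \mathbb{Z}^2$ for a lattice triangle $\Delta$. A triangle is minimal if it contains exactly $4$ points of $\mathbb{Z}^2$; a minimal triangle is a border triangle if its non-vertex point lies on the boundary of $\Delta$, and an internal triangle if that point lies in the interior of $\Delta$. A set $S \subseteq \mathbb{Z}^2$ is B-stable if no border triangle has exactly three of its points in $S$; I-stable if no internal triangle has exactly three of its points in $S$; BI-stable if both. A maximal B-stable (resp. I-stable, BI-stable) set is a B-stable (resp. I-stable, BI-stable) proper subset $S \subsetneq \mathbb{Z}^2$ such that no B-stable (resp. I-stable, BI-stable) proper subset of $\mathbb{Z}^2$ properly contains $S$. A set is periodic if it is of the form $X + k\mathbb{Z}^2$ for some finite $X \subset \mathbb{Z}^2$ and positive integer $k$. A unimodular transformation is a map $x \mapsto Mx + b$ with $M$ an integer $2\times 2$ matrix of determinant $\pm1$ and $b\in\mathbb{Z}^2$.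 Let $\Delta_0 = \{(0,0),(1,0),(0,1),(-1,-1)\}$, $J_{1/4} = \Delta_0 + 4\mathbb{Z}^2$ and $J_{1/2} = J_{1/4} \cup (J_{1/4} + (2,2))$. *)

(* Defs.v *)
From HB Require Import structures.
From mathcomp Require Import all_boot all_order all_algebra.
From mathcomp Require Import all_classical all_reals all_analysis.

Set Implicit Arguments.
Unset Strict Implicit.
Unset Printing Implicit Defensive.

Import Order.TTheory GRing.Theory Num.Theory.
Import numFieldNormedType.Exports.

Local Open Scope classical_set_scope.
Local Open Scope ring_scope.
Local Open Scope card_scope.

Notation Z2 := (int * int)%type.

Section Triangles.
Variable R : realType.
Notation plane := (R * R)%type.

Definition toplane (p : Z2) : plane := (p.1%:~R, p.2%:~R).

Definition collinear (a b c : plane) : Prop :=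
  exists o d : plane,
    [set a; b; c] `<=` [set o + t *: d | t in [set: R]].

Definition hull3 (a b c : plane) : set plane :=
  [set x | exists r s t : R,
    [/\ 0 <= r, 0 <= s, 0 <= t, r + s + t = 1 &
        x = r *: a + s *: b + t *: c]].

Definition boundary (D : set plane) : set plane := closure D `\` D°.

Definition lattice_triangle (D : set plane) (a b c : Z2) : Prop :=
  ~ collinear (toplane a) (toplane b) (toplane c) /\
  D = hull3 (toplane a) (toplane b) (toplane c).

Definition lattice_points (D : set plane) : set Z2 := toplane @^-1` D.

(* [loc D] is the region in which the non-vertex point must lie. *)
Definition minimal_triangle_with (loc : set plane -> set plane) (T : set Z2) :
    Prop :=
  exists (D : set plane) (a b c : Z2),
    [/\ lattice_triangle D a b c, T = lattice_points D, T #= `I_4 &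
        exists p, [/\ T p, ~ [set a; b; c] p & loc D (toplane p)]].

Definition border_triangle : set (set Z2) := minimal_triangle_with boundary.
Definition internal_triangle : set (set Z2) :=
  minimal_triangle_with (fun D => D°).

Definition B_stable (S : set Z2) : Prop :=
  forall T, border_triangle T -> ~ (T `&` S #= `I_3).
Definition I_stable (S : set Z2) : Prop :=
  forall T, internal_triangle T -> ~ (T `&` S #= `I_3).
Definition BI_stable (S : set Z2) : Prop := B_stable S /\ I_stable S.

End Triangles.

Definition maximal_set (stable : set Z2 -> Prop) (S : set Z2) : Prop :=
  [/\ stable S, S `<` setT &
      forall S', stable S' -> S' `<` setT -> ~ (S `<` S')].

Definition minkowski (A B : set Z2) : set Z2 := [set x + y | x in A & y in B].

Definition scaled_lattice (k : nat) : set Z2 := [set v *+ k | v in [set: Z2]].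

Definition periodic_set (S : set Z2) : Prop :=
  exists (X : set Z2) (k : nat),
    [/\ finite_set X, (0 < k)%N & S = minkowski X (scaled_lattice k)].

Definition unimodular (f : Z2 -> Z2) : Prop :=
  exists (M : 'M[int]_2) (b : Z2), (\det M = 1 \/ \det M = -1) /\
    forall x, f x = (M 0 0 * x.1 + M 0 1 * x.2, M 1 0 * x.1 + M 1 1 * x.2) + b.

Definition unimodular_image (A S : set Z2) : Prop :=
  exists2 f, unimodular f & S = f @` A.

Definition Delta0 : set Z2 := [set (0, 0); (1, 0); (0, 1); (-1, -1)].
Definition J_quarter : set Z2 := minkowski Delta0 (scaled_lattice 4).
Definition J_half : set Z2 :=
  J_quarter `|` minkowski J_quarter [set (2%:Z, 2%:Z)].

(* Main.v *)
(* Writing [det u v = +-1], border triangles are the sets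
   [{p, p + u, p - u, p + v}] and internal triangles the sets
   [{p, p + u, p + v, p - u - v}] (a lattice triangle without further lattice
   points has determinant 1), so that stability means closure under
   "three points of the quadruple give the fourth".

   A B-stable set containing a unimodular triangle [p, p + u, p + v] contains
   [p - u], hence the two neighbouring lines parallel to [u], hence everything;
   this gives (a). An I-stable set containing [Delta0] contains [J_quarter] by a
   finite closure computation and 4-periodicity. [Z^2] is the disjoint union
   of the four translates of [J_quarter] by vectors of [2 Z^2]; further finite
   computations show that the set contains each translate it meets, and all of
   them once it meets three; this gives (b).

   The six points [(r, r (r + 1) / 2)], [-3 <= r <= 2], generate [Z^2] under
   either kind of closure, so that unions of chains of proper stable sets are
   proper and Zorn's lemma yields (c). For (d), three points of the parabola
   [y = x (x + 1) / 2] with abscissas at distance at least 2 span a triangle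
   too large to lie in a minimal triangle, so the points with [x >= 0] even or
   [x <= -3] odd form a stable set; a periodic set containing them contains the
   whole parabola, hence the six generators. *)

Require Import Defs.
From HB Require Import structures.
From mathcomp Require Import all_boot all_order all_algebra.
From mathcomp Require Import all_classical all_reals all_analysis.
From mathcomp Require Import ring lra zify.
Import Order.TTheory GRing.Theory Num.Theory.
Import numFieldNormedType.Exports.
Local Open Scope classical_set_scope.
Local Open Scope ring_scope.

Set Implicit Arguments.
Unset Strict Implicit.
Unset Printing Implicit Defensive.

(** * Stability as closure under quadruples *)

Definition det (u v : Z2) : int := u.1 * v.2 - u.2 * v.1.

Definition unimod (u v : Z2) : bool := `|det u v| == 1.

Definition bquad (p u v : Z2) : seq Z2 := [:: p; p + u; p - u; p + v].

Definition iquad (p u v : Z2) : seq Z2 := [:: p; p + u; p + v; p - u - v].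

Definition quads (q : Z2 -> Z2 -> Z2 -> seq Z2) : set (seq Z2) :=
  [set s | exists p u v, unimod u v /\ s = q p u v].

(** For a duplicate-free quadruple, failing this rule at some [x] amounts to having exactly three
    points in [S]. The finitary form suits both chain arguments and evaluation. *)
Definition rule_closed (Q : set (seq Z2)) (S : set Z2) : Prop :=
  forall s x, Q s -> x \in s -> (forall y, y \in s -> y != x -> S y) -> S x.

Lemma eqZ2 (a b : Z2) : a.1 = b.1 -> a.2 = b.2 -> a = b.
Proof. exact: injective_projections. Qed.

Lemma addZ2 (a b c d : int) : (a, b) + (c, d) = (a + c, b + d) :> Z2.
Proof. by []. Qed.

Lemma oppZ2 (a b : int) : - (a, b) = (- a, - b) :> Z2.
Proof. by []. Qed.

Lemma unimodP (u v : Z2) : unimod u v -> det u v = 1 \/ det u v = -1.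
Proof. by rewrite /unimod; lia. Qed.

Lemma unimod_sqr (u v : Z2) : unimod u v -> det u v * det u v = 1.
Proof. by case/unimodP=> ->. Qed.

(** Coordinates in the affine frame with origin [p] and basis [u], [v]; taking [p = 0] gives the
    linear part. *)
Definition aff (p u v x : Z2) : Z2 :=
  (p.1 + x.1 * u.1 + x.2 * v.1, p.2 + x.1 * u.2 + x.2 * v.2).

(** Cramer's rule: the determinant is its own inverse, so the coordinates are integers. *)
Lemma aff_surj (p u v q : Z2) : unimod u v -> exists x, aff p u v x = q.
Proof.
move=> /unimod_sqr e; exists (det u v * det (q - p) v, det u v * det u (q - p)).
case: p u v q e => [p1 p2] [u1 u2] [v1 v2] [q1 q2].
rewrite /det /aff oppZ2 addZ2 /= => e.
apply: eqZ2 => /=.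
- by transitivity (p1 + (q1 - p1) * ((u1 * v2 - u2 * v1) * (u1 * v2 - u2 * v1)));
    [ring | rewrite e; ring].
- by transitivity (p2 + (q2 - p2) * ((u1 * v2 - u2 * v1) * (u1 * v2 - u2 * v1)));
    [ring | rewrite e; ring].
Qed.

Lemma aff_comp (p u v a b c x : Z2) :
  aff p u v (aff a b c x) =
  aff (aff p u v a) (aff 0 u v b) (aff 0 u v c) x.
Proof. by rewrite /aff; apply: eqZ2 => /=; ring. Qed.

Lemma affD (p u v a b : Z2) : aff p u v (a + b) = aff p u v a + aff 0 u v b.
Proof. by case: a b => [? ?] [? ?]; rewrite /aff !addZ2 /=; apply: eqZ2 => /=; ring. Qed.

Lemma aff0N (u v a : Z2) : aff 0 u v (- a) = - aff 0 u v a.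
Proof. by case: a => [? ?]; rewrite /aff !oppZ2 /=; apply: eqZ2 => /=; ring. Qed.

Lemma aff_translation (a x : Z2) : aff a (1, 0) (0, 1) x = a + x.
Proof. by rewrite /aff; apply: eqZ2 => /=; ring. Qed.

Lemma det_aff (u v a b : Z2) :
  det (aff 0 u v a) (aff 0 u v b) = det u v * det a b.
Proof. by rewrite /det /aff /=; ring. Qed.

Lemma unimod_aff (u v a b : Z2) :
  unimod u v -> unimod a b -> unimod (aff 0 u v a) (aff 0 u v b).
Proof. by rewrite /unimod det_aff normrM => /eqP-> /eqP->. Qed.

Lemma aff_unimodular (p u v : Z2) : unimod u v -> unimodular (aff p u v).
Proof.
move=> uv.
pose M : 'M[int]_2 := \matrix_(i, j) 
  (if j == 0 then (if i == 0 then u.1 else u.2)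
   else if i == 0 then v.1 else v.2).
exists M, p; split.
  have -> : \det M = det u v.
    rewrite (expand_det_row _ 0) !big_ord_recl big_ord0 /cofactor !det_mx11 !mxE /=.
    by rewrite /det; ring.
  exact: unimodP.
by move=> x; rewrite !mxE /=; apply: eqZ2 => /=; ring.
Qed.

(** A unimodular frame multiplies determinants by a unit, so it carries internal quadruples to
    internal quadruples. This reduces any internal triangle to [delta0]. *)
Lemma iclosed_aff (S : set Z2) (p u v : Z2) : unimod u v ->
  rule_closed (quads iquad) S -> rule_closed (quads iquad) (aff p u v @^-1` S).
Proof.
move=> uv clS _ x [q [a [b [ab ->]]]] xs Sy.
have E : map (aff p u v) (iquad q a b) =
    iquad (aff p u v q) (aff 0 u v a) (aff 0 u v b).
  by rewrite /iquad /= !affD !aff0N.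
apply: (clS (map (aff p u v) (iquad q a b))).
- by exists (aff p u v q), (aff 0 u v a), (aff 0 u v b); split=> //; exact: unimod_aff.
- exact: map_f.
- move=> _ /mapP[y ys ->] yx; apply: Sy => //.
  by apply: contraNneq yx => ->.
Qed.

(** The plane is filled row by row in the frame: every point of row 1 is an apex over [p - u], [p],
    [p + u], and a full row then fills the rows on both sides of it. *)
Lemma bclosed_setT (S : set Z2) (p u v : Z2) :
  rule_closed (quads bquad) S -> unimod u v -> S p -> S (p + u) -> S (p + v) ->
  S = setT.
Proof.
move=> clS uv Sp Spu Spv.
have uE i j : unimod u (aff 0 u v (i, j)) = (`|j| == 1).
  have -> : unimod u (aff 0 u v (i, j)) = (`|det u v * j| == 1).
    by congr (`|_| == 1); rewrite /det /aff /=; ring.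
  by rewrite normrM (eqP uv) mul1r.
have apex q w : unimod u w -> S q -> S (q + u) -> S (q - u) -> S (q + w).
  move=> uw Sq Squ Squ'; apply: (clS (bquad q u w)); first by exists q, u, w.
    by rewrite !inE eqxx !orbT.
  by move=> y; rewrite !inE => /or4P[]/eqP-> //; rewrite eqxx.
have Spu' : S (p - u).
  apply: (clS (bquad p u v)); first by exists p, u, v.
    by rewrite !inE eqxx !orbT.
  by move=> y; rewrite !inE => /or4P[]/eqP-> //; rewrite eqxx.
have row1 i : S (aff p u v (i, 1)).
  have -> : aff p u v (i, 1) = p + aff 0 u v (i, 1).
    by rewrite /aff; apply: eqZ2 => /=; ring.
  by apply: apex => //; rewrite uE.
have next j (e : int) : `|e| == 1 -> (forall i, S (aff p u v (i, j))) ->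
    forall i, S (aff p u v (i, j + e)).
  move=> e1 Sj i.
  have -> : aff p u v (i, j + e) = aff p u v (i, j) + aff 0 u v (0, e).
    by rewrite -affD addZ2 addr0.
  apply: apex; rewrite ?uE //.
  - have -> : aff p u v (i, j) + u = aff p u v (i + 1, j); last exact: Sj.
    by rewrite /aff; apply: eqZ2 => /=; ring.
  - have -> : aff p u v (i, j) - u = aff p u v (i - 1, j); last exact: Sj.
    by rewrite /aff; apply: eqZ2 => /=; ring.
(* So far only three points of row 0 are known; the full row comes from row 1 by descending. *)
have row0 i : S (aff p u v (i, 0)) by rewrite -(subrr 1); exact: next.
have row j : forall i, S (aff p u v (i, j)).
  elim/int_rect: j => [|n IH|n IH]; first exact: row0.
  - by rewrite -addn1 PoszD; exact: next.
  - by rewrite -addn1 PoszD opprD; exact: next.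
apply/seteqP; split=> // q _.
by have [[i j] <-] := @aff_surj p u v q uv; exact: row.
Qed.

(** * Finite closure computations *)

Definition step (L : seq Z2) (t : Z2 * Z2 * Z2) : seq Z2 :=
  let s := iquad t.1.1 t.1.2 t.2 in
  (* Applicability is tested when the list is run, so soundness holds for any list of triples,
     however it was found. *)
  if unimod t.1.2 t.2 && (size [seq y <- s | y \notin L] <= 1)%N
  then s ++ L else L.

Lemma rule_closed_one_missing (Q : set (seq Z2)) (S : set Z2) (L s : seq Z2) :
  rule_closed Q S -> Q s -> {in L, forall y, S y} ->
  (size [seq y <- s | y \notin L] <= 1)%N -> {in s ++ L, forall y, S y}.
Proof.
move=> clS Qs SL small y; rewrite mem_cat => /orP[ys|]; last exact: SL.
have filE z := mem_filter (fun y => y \notin L) z s.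
case: [seq y <- s | y \notin L] small filE => [|x [|//]] _ filE.
  by apply: SL; apply: contraT => yL; have := filE y; rewrite yL ys.
have inx z : z \in s -> (z \in L) || (z == x).
  by move=> zs; have := filE z; rewrite inE zs andbT => ->; case: (z \in L).
have Sx : S x.
  apply: (clS s) => //.
    by have := filE x; rewrite inE eqxx => /esym /andP[].
  by move=> z /inx /orP[/SL//|->].
by case/orP: (inx y ys) => [/SL//|/eqP->].
Qed.

Lemma foldl_step_sound (S : set Z2) (L : seq Z2) (ts : seq (Z2 * Z2 * Z2)) :
  rule_closed (quads iquad) S -> {in L, forall y, S y} ->
  {in foldl step L ts, forall y, S y}.
Proof.
move=> clS; elim: ts L => [|[[p u] v] ts IH] L SL //.
apply: IH; rewrite /step; case: ifP => // /andP[uv small].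
by apply: (@rule_closed_one_missing _ S L _ clS) => //; exists p, u, v.
Qed.

(* Found by a breadth-first search. Each triple [(p, u, v)] stands for the
   internal triangle [iquad p u v]; inapplicable ones are skipped by [step], so
   that the same list serves all the finite closure computations below. *)
Definition steps : seq (Z2 * Z2 * Z2) := [::
   ((1, 0), (-1, 1), (-1, 0)); ((1, 0), (-1, 0), (-2, -1)); ((0, 1), (0, -1), (1, -1));
   ((0, 0), (0, 1), (-1, 3)); ((3, -1), (1, 2), (-2, -3)); ((0, 1), (1, -1), (3, -2));
   ((-1, -1), (2, -3), (-3, 5)); ((3, -1), (1, 1), (-3, -2)); ((0, 0), (1, 0), (4, 1));
   ((1, 0), (-2, 3), (-1, 1)); ((0, 0), (3, -1), (1, 0)); ((-1, -1), (5, -3), (-3, 2));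
   ((-4, 0), (-1, -1), (1, 0)); ((0, 1), (-1, -2), (0, -1)); ((-1, 3), (-3, -2), (2, 1));
   ((-1, 3), (-2, -3), (1, 1)); ((0, 0), (1, 4), (0, 1)); ((0, -4), (-1, -1), (1, 0));
   ((2, 0), (-2, 1), (1, -1)); ((1, 0), (-2, -1), (1, 0)); ((1, -1), (-1, -2), (1, 1));
   ((3, 0), (-2, -1), (1, 0)); ((2, 1), (-3, 2), (1, -1)); ((0, 3), (-1, 0), (0, -1));
   ((-1, 1), (-3, -1), (1, 0)); ((0, 3), (-1, -2), (1, 1)); ((0, 1), (-4, -1), (1, 0));
   ((1, 0), (-2, -5), (1, 2)); ((1, 1), (-1, 2), (0, -1)); ((1, 1), (-1, 1), (-1, 0));
   ((2, 1), (-2, 1), (-1, 0)); ((-1, 1), (1, 1), (1, 2)); ((1, 0), (0, 1), (-1, 0));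
   ((1, -1), (-4, -1), (1, 0)); ((1, 2), (-2, 1), (-1, 0)); ((0, 1), (-3, -1), (1, 0));
   ((0, 1), (-4, -1), (1, 0)); ((1, 1), (1, 2), (-1, -1)); ((-2, 1), (1, -1), (-1, 2));
   ((-1, 0), (1, 0), (-1, 1)); ((-1, 0), (-1, 0), (0, -1)); ((0, 0), (-2, 1), (-1, 0));
   ((1, 0), (-3, 1), (2, -1)); ((0, 0), (1, 1), (-1, 0)); ((-1, 0), (1, -1), (-2, 3));
   ((-1, -1), (1, 1), (0, 1)); ((0, -1), (1, 1), (0, 1)); ((0, -2), (-2, -1), (-1, -1));
   ((0, 0), (-1, 0), (-1, -1)); ((-1, 0), (-1, 1), (-1, 0)); ((-1, 0), (1, -1), (1, 0));
   ((0, 0), (-1, -1), (0, -1)); ((0, 2), (-3, -1), (1, 0)); ((-2, 0), (1, 0), (0, 1));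
   ((-1, -1), (1, 0), (1, 1)); ((-2, 0), (-1, -1), (-1, -2)); ((-1, 0), (-1, 0), (1, -1));
   ((-1, 0), (2, 1), (-1, 0)); ((-1, 0), (-2, -1), (-1, -1)); ((0, 0), (-2, -1), (-1, -1))
].

Definition delta0 : seq Z2 := [:: (0, 0); (1, 0); (0, 1); (-1, -1)].

Definition shift (t : Z2) (L : seq Z2) : seq Z2 := [seq t + x | x <- L].

Lemma closure_sub (L G : seq Z2) (S : set Z2) :
  all (mem (foldl step L steps)) G -> rule_closed (quads iquad) S ->
  {in L, forall y, S y} -> {in G, forall y, S y}.
Proof. by move=> /allP LG clS SL y /LG; exact: foldl_step_sound. Qed.

Lemma delta0_neighbors (S : set Z2) (e : Z2) : rule_closed (quads iquad) S ->
  {in delta0, forall y, S y} -> e \in [:: (4, 0); (-4, 0); (0, 4); (0, -4)] ->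
  {in shift e delta0, forall y, S y}.
Proof.
move=> clS SD; rewrite !inE => /or4P[]/eqP->;
  by apply: (closure_sub _ clS SD); vm_compute.
Qed.

(** * I-stable sets containing an internal triangle *)

Lemma in_shift (S : set Z2) (w : Z2) (L : seq Z2) :
  {in shift w L, forall y, S y} <-> {in L, forall y, S (w + y)}.
Proof.
split=> SL y; first by move=> yL; apply: SL; exact: map_f.
by case/mapP=> x xL ->; exact: SL.
Qed.

Lemma iclosed_translation (S : set Z2) (w : Z2) :
  rule_closed (quads iquad) S -> rule_closed (quads iquad) [set x | S (w + x)].
Proof.
move=> clS; rewrite (_ : [set x | _] = aff w (1, 0) (0, 1) @^-1` S).
  exact: iclosed_aff.
by apply/funext => x; rewrite /= aff_translation.
Qed.

Lemma mulr4Z2 (v : Z2) : v *+ 4 = (v.1 * 4, v.2 * 4).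
Proof. by apply: eqZ2 => /=; ring. Qed.

(** Steps of length 4 along the axes are chained: the induction on [j] at [i = 0] builds a column,
    and the induction on [i] spreads it sideways. *)
Lemma delta0_lattice (S : set Z2) (a v : Z2) : rule_closed (quads iquad) S ->
  {in shift a delta0, forall y, S y} -> {in shift (a + v *+ 4) delta0, forall y, S y}.
Proof.
move=> clS; set P := fun w => {in shift w delta0, forall y, S y}.
have nextP w (e : Z2) : e \in [:: (4, 0); (-4, 0); (0, 4); (0, -4)] -> P w -> P (w + e).
  move=> ein /in_shift Pw; apply/in_shift => y yD; rewrite -addrA.
  move: (delta0_neighbors (@iclosed_translation S w clS) Pw ein) => /in_shift.
  exact.
move=> Pa; rewrite -/(P _); case: v => i j.
elim/int_rect: i => [|n IH|n IH].
- elim/int_rect: j => [|n IH|n IH].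
  + by rewrite mulr4Z2 /= !mul0r addr0.
  + have -> : a + (0%:Z, n.+1%:Z) *+ 4 = a + (0%:Z, n%:Z) *+ 4 + (0, 4).
      by rewrite !mulr4Z2; apply: eqZ2 => /=; lia.
    exact: nextP.
  + have -> : a + (0%:Z, - n.+1%:Z) *+ 4 = a + (0%:Z, - n%:Z) *+ 4 + (0, -4).
      by rewrite !mulr4Z2; apply: eqZ2 => /=; lia.
    exact: nextP.
- have -> : a + (n.+1%:Z, j) *+ 4 = a + (n%:Z, j) *+ 4 + (4, 0).
    by rewrite !mulr4Z2; apply: eqZ2 => /=; lia.
  exact: nextP.
- have -> : a + (- n.+1%:Z, j) *+ 4 = a + (- n%:Z, j) *+ 4 + (-4, 0).
    by rewrite !mulr4Z2; apply: eqZ2 => /=; lia.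
  exact: nextP.
Qed.

(** Representatives of the nonzero classes of [2 Z^2] modulo [4 Z^2]. *)
Definition half_periods : seq Z2 := [:: (2, 0); (0, 2); (2, 2)].

(** Twelve evaluations, one for each half period and each point of [delta0]: a single point of the
    translate recovers the rest of it. *)
Lemma delta0_half_period (S : set Z2) (t d : Z2) : rule_closed (quads iquad) S ->
  {in delta0, forall y, S y} -> t \in half_periods -> d \in delta0 -> S (t + d) ->
  {in shift t delta0, forall y, S y}.
Proof.
move=> clS SD tT dD Std; apply: (@closure_sub (t + d :: delta0) _ S _ clS).
  have : all (fun t => all (fun d =>
      all (mem (foldl step (t + d :: delta0) steps)) (shift t delta0)) delta0) half_periods.
    by vm_compute.
  by move=> /allP/(_ _ tT)/allP/(_ _ dD).
by move=> y; rewrite in_cons => /orP[/eqP->|/SD].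
Qed.

(** Computing the single point [t] is enough, since [inJ_translate_sub] spreads it to its whole
    translate of [J_quarter]. *)
Lemma delta0_third_period (S : set Z2) (t : Z2) : rule_closed (quads iquad) S ->
  {in delta0, forall y, S y} -> t \in half_periods ->
  (forall s, s \in half_periods -> s != t -> {in shift s delta0, forall y, S y}) ->
  S t.
Proof.
move=> clS SD tT Ss.
pose L r := delta0 ++ flatten [seq if s == r then [::] else shift s delta0 | s <- half_periods].
have SL : {in L t, forall y, S y}.
  move=> y; rewrite mem_cat => /orP[/SD//|/flatten_mapP[s sT]].
  by case: eqVneq => [_|st ys]; [rewrite in_nil|exact: (Ss s sT st y ys)].
have : all (fun r => r \in foldl step (L r) steps) half_periods by vm_compute.
by move=> /allP/(_ _ tT); exact: foldl_step_sound SL _.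
Qed.

(** Residue test for [J_quarter], where (3, 3) is the class of (-1, -1). Being boolean and
    4-periodic, it lets statements about the plane be decided on 16 residues. *)
Definition inJ (q : Z2) : bool :=
  ((q.1 %% 4)%Z, (q.2 %% 4)%Z) \in [:: (0, 0); (1, 0); (0, 1); (3, 3)].

Lemma inJD (q v : Z2) : inJ (q + v *+ 4) = inJ q.
Proof. by rewrite /inJ mulr4Z2 /= ![_ + _ * 4]addrC !modzMDl. Qed.

Definition residues : seq Z2 := [seq (Posz i, Posz j) | i <- iota 0 4, j <- iota 0 4].

Lemma residuesP (q : Z2) : exists2 r, r \in residues & exists v, q = r + v *+ 4.
Proof.
exists ((q.1 %% 4)%Z, (q.2 %% 4)%Z); last first.
  exists ((q.1 %/ 4)%Z, (q.2 %/ 4)%Z); rewrite mulr4Z2.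
  by apply: eqZ2 => /=; rewrite addrC -divz_eq.
have mod4 (x : int) : exists2 i, i \in iota 0 4 & (x %% 4)%Z = Posz i.
  exists `|(x %% 4)%Z|%N; last by rewrite gez0_abs // modz_ge0.
  by rewrite mem_iota /=; lia.
have [i iI ->] := mod4 q.1; have [j jI ->] := mod4 q.2.
by apply/allpairsP; exists (i, j).
Qed.

Lemma forall_residues (P : pred Z2) : (forall q v, P (q + v *+ 4) = P q) ->
  all P residues -> forall q, P q.
Proof. by move=> PD /allP Pr q; have [r /Pr ? [v ->]] := residuesP q; rewrite PD. Qed.

Lemma inJP (q : Z2) : reflect (exists v, q \in shift (v *+ 4) delta0) (inJ q).
Proof.
apply: (iffP idP) => [|[v /mapP[d dD ->]]]; last first.
  by rewrite addrC inJD; move: dD; rewrite !inE => /or4P[]/eqP->.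
have [r rR [v ->]] := residuesP q; rewrite inJD => rJ.
(* Among the residues passing the test only (3, 3) is outside [delta0]; it is (-1, -1) shifted by 4
   times (1, 1). *)
have : all (fun r => inJ r ==> has (fun w => r \in shift (w *+ 4) delta0)
    [:: (0, 0); (1, 1)]) residues by vm_compute.
move=> /allP/(_ _ rR)/implyP/(_ rJ)/hasP[w _ /mapP[d dD ->]].
exists (w + v); rewrite addrAC -mulrnDl; exact: map_f.
Qed.

Lemma inJ_cover (q : Z2) : inJ q \/ exists2 t, t \in half_periods & inJ (q - t).
Proof.
have : inJ q || has (fun t => inJ (q - t)) half_periods.
  move: q; apply: forall_residues => [q v|]; last by vm_compute.
  by rewrite inJD; congr (_ || _); apply: eq_has => t; rewrite addrAC inJD.
by case/orP=> [|/hasP[t]]; [left|right; exists t].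
Qed.

Lemma inJ_sub (S : set Z2) (q : Z2) : rule_closed (quads iquad) S ->
  {in delta0, forall y, S y} -> inJ q -> S q.
Proof.
move=> clS SD /inJP[v]; move: q; rewrite -[v *+ 4]add0r.
by apply: delta0_lattice => //; apply/in_shift => y; rewrite add0r; exact: SD.
Qed.

(** After a translation by a multiple of 4 the known point is [t + d] with [d] in [delta0]. This
    gives one copy of [delta0] in the translate, and [delta0_lattice] gives the others. *)
Lemma inJ_translate_sub (S : set Z2) (t q q' : Z2) :
  rule_closed (quads iquad) S -> {in delta0, forall y, S y} -> t \in half_periods ->
  inJ (q - t) -> S q -> inJ (q' - t) -> S q'.
Proof.
move=> clS SD tT /inJP[v /mapP[d dD qE]] Sq.
have {}qE : q = v *+ 4 + (t + d) by rewrite addrCA -qE addrC subrK.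
have St : {in shift (v *+ 4 + t) delta0, forall y, S y}.
  apply/in_shift => y yD; rewrite -addrA.
  suff /in_shift : {in shift t delta0, forall y, S (v *+ 4 + y)} by exact.
  apply: (@delta0_half_period [set y | S (v *+ 4 + y)] t d) => //=.
  - exact: iclosed_translation.
  - by move=> z zD; apply: (inJ_sub clS SD); apply/inJP; exists v; exact: map_f.
  - by rewrite -qE.
move=> /inJP[w /mapP[d' d'D q'E]].
have -> : q' = (v *+ 4 + t + (w - v) *+ 4) + d'.
  by rewrite -(subrK t q') q'E !mulr4Z2; apply: eqZ2 => /=; ring.
by apply: (@delta0_lattice S (v *+ 4 + t) (w - v) clS St); exact: map_f.
Qed.

(** The cases count the half periods whose translate of [J_quarter] meets [S]: none, exactly one, or
    at least two. *)
Lemma iclosed_normal_form (S : set Z2) : rule_closed (quads iquad) S ->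
  {in delta0, forall y, S y} ->
  [\/ S = [set q | inJ q],
      exists2 t, t \in half_periods & S = [set q | inJ q || inJ (q - t)] |
      S = setT].
Proof.
move=> clS SD; pose has t := exists2 q, S q & inJ (q - t).
have hasS t q : t \in half_periods -> has t -> inJ (q - t) -> S q.
  by move=> tT [q' Sq' q'J]; exact: (inJ_translate_sub clS SD tT q'J Sq').
have [[t tT ht]|noT] := pselect (exists2 t, t \in half_periods & has t); last first.
  constructor 1; apply/seteqP; split=> q /=; last exact: (inJ_sub clS SD).
  move=> Sq; have [//|[t tT qJ]] := inJ_cover q.
  by case: noT; exists t => //; exists q.
have [[s [sT st hs]]|noS] :=
  pselect (exists s, [/\ s \in half_periods, s != t & has s]); last first.
  constructor 2; exists t => //; apply/seteqP; split=> q /=.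
    move=> Sq; have [->//|[s sT qJ]] := inJ_cover q.
    have [<-|st] := eqVneq s t; first by rewrite qJ orbT.
    by case: noS; exists s; split=> //; exists q.
  by case/orP; [exact: (inJ_sub clS SD)|exact: (hasS _ _ tT ht)].
(* Two half periods are met, so the third is met as well by [delta0_third_period], and the four
   translates cover the plane. *)
constructor 3; apply/seteqP; split=> // q _.
have hasall r : r \in half_periods -> has r.
  move=> rT; have [->//|rt] := eqVneq r t; have [->//|rs] := eqVneq r s.
  exists r; last by rewrite subrr.
  apply: (delta0_third_period clS SD rT) => r' r'T r'r.
  have hr' : has r'.
    by move: rT tT sT r'T st rt rs r'r ht hs; rewrite !inE
      => /or3P[]/eqP-> /or3P[]/eqP-> /or3P[]/eqP-> /or3P[]/eqP->.
  by apply/in_shift => y yD; apply: (hasS r' _ r'T hr'); rewrite addrC addKr;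
    apply/inJP; exists 0; apply/mapP; exists y => //; rewrite mul0rn add0r.
have [|[r rT]] := inJ_cover q; first exact: (inJ_sub clS SD).
exact: (hasS _ _ rT (hasall r rT)).
Qed.

Lemma J_quarterE : J_quarter = [set q | inJ q].
Proof.
have D0E d : Delta0 d <-> d \in delta0.
  by rewrite /Delta0 /= !inE; split=> [[[[->|->]|->]|->]|
    /or4P[]/eqP->]; rewrite ?eqxx ?orbT //; tauto.
apply/seteqP; split=> q /=.
- move=> [d /D0E dD [_ [v _ <-] <-]]; apply/inJP; exists v.
  by rewrite addrC; exact: map_f.
- move=> /inJP[v /mapP[d /D0E dD ->]]; exists d => //; exists (v *+ 4).
    by exists v.
  by rewrite addrC.
Qed.

Lemma J_halfE : J_half = [set q | inJ q || inJ (q - (2, 2))].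
Proof.
rewrite /J_half J_quarterE; apply/seteqP; split=> q /=.
- by case=> [->//|[r rJ [_ -> <-]]]; rewrite addrK rJ orbT.
- case/orP=> qJ; [by left|right; exists (q - (2, 2)) => //; exists (2, 2) => //].
  by rewrite subrK.
Qed.

(* The rotations of [Delta0] permute the three half periods modulo 4. *)
Lemma half_period_unimodular (t : Z2) : t \in half_periods ->
  exists u v, unimod u v /\
    [set q | inJ q || inJ (q - t)] = aff 0 u v @` J_half.
Proof.
have image (u v u' v' s : Z2) : unimod u v ->
    (forall x, aff 0 u v (aff 0 u' v' x) = x) ->
    all (fun r => inJ r || inJ (r - s) ==>
      inJ (aff 0 u' v' r) || inJ (aff 0 u' v' r - (2, 2))) residues ->
    all (fun r => inJ r || inJ (r - (2, 2)) ==>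
      inJ (aff 0 u v r) || inJ (aff 0 u v r - s)) residues ->
    exists u v, unimod u v /\
      [set q | inJ q || inJ (q - s)] = aff 0 u v @` J_half.
  move=> uv fg; have aff4 a b q w : aff 0 a b (q + w *+ 4) =
      aff 0 a b q + (aff 0 a b w) *+ 4.
    by rewrite affD; congr (_ + _); rewrite !mulr4Z2 /aff; apply: eqZ2 => /=; ring.
  have inJD2 q w z : inJ (q + w *+ 4 - z) = inJ (q - z) by rewrite addrAC inJD.
  move=> /forall_residues gJ /forall_residues fJ.
  exists u, v; split=> //; rewrite J_halfE; apply/seteqP; split=> [q /= qJ|_ [x /= xJ <-]].
  - exists (aff 0 u' v' q); last exact: fg.
    apply: implyP qJ; apply: gJ => x w.
    by rewrite aff4 !inJD !inJD2.
  - by apply: implyP xJ; apply: fJ => y w; rewrite aff4 !inJD !inJD2.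
rewrite !inE => /or3P[]/eqP->.
(* The rotation (1, 0) -> (0, 1) -> (-1, -1) -> (1, 0) sends (2, 2) to (-2, 0), congruent to (2, 0)
   modulo 4. Its square, which is its inverse, sends (2, 2) to (0, -2), congruent to (0, 2). *)
- apply: (@image (0, 1) (-1, -1) (-1, -1) (1, 0)) => //; try by vm_compute.
  by move=> x; rewrite /aff; apply: eqZ2 => /=; ring.
- apply: (@image (-1, -1) (1, 0) (0, 1) (-1, -1)) => //; try by vm_compute.
  by move=> x; rewrite /aff; apply: eqZ2 => /=; ring.
- apply: (@image (1, 0) (0, 1) (1, 0) (0, 1)) => //; try by vm_compute.
  by move=> x; rewrite /aff; apply: eqZ2 => /=; ring.
Qed.

(** Pulling [S] back along the frame [p], [u], [v] turns the triangle into [delta0], where the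
    normal form applies. *)
Lemma iclosed_internal (S : set Z2) (p u v : Z2) :
  rule_closed (quads iquad) S -> unimod u v -> {in iquad p u v, forall y, S y} ->
  unimodular_image J_quarter S \/ unimodular_image J_half S \/
  unimodular_image setT S.
Proof.
move=> clS uv Spuv; pose f := aff p u v.
have clf : rule_closed (quads iquad) (f @^-1` S) by exact: iclosed_aff.
have SE : S = f @` (f @^-1` S).
  apply/seteqP; split=> [q Sq|_ [x Sx <-]//].
  by have [x xq] := aff_surj p q uv; exists x; rewrite /= /f xq.
have SfD : {in delta0, forall y, (f @^-1` S) y}.
  move=> y; rewrite !inE => /or4P[]/eqP-> /=; apply: Spuv; rewrite !inE.
  - by apply/or4P/Or41/eqP/eqZ2; rewrite /f /aff /=; ring.
  - by apply/or4P/Or42/eqP/eqZ2; rewrite /f /aff /=; ring.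
  - by apply/or4P/Or43/eqP/eqZ2; rewrite /f /aff /=; ring.
  - by apply/or4P/Or44/eqP/eqZ2; rewrite /f /aff /=; ring.
have [E|[t /half_period_unimodular[a [b [ab ->]]] E]|E] := iclosed_normal_form clf SfD.
- left; exists f; first exact: aff_unimodular.
  by rewrite SE E J_quarterE.
- right; left; exists (aff (f 0) (aff 0 u v a) (aff 0 u v b)).
    by apply: aff_unimodular; exact: unimod_aff.
  rewrite SE E image_comp.
  by congr (_ @` _); apply/funext => x; rewrite /= /f aff_comp.
- right; right; exists f; first exact: aff_unimodular.
  by rewrite SE E.
Qed.

(** * Maximal closed sets *)

Lemma proper_setT (A : set Z2) : A `<` setT <-> A <> setT.
Proof.
split=> [[_ nTA] AT|AT]; first by apply: nTA; rewrite AT.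
by split=> // TA; apply: AT; apply/seteqP.
Qed.

Lemma chain_seq (F : set (set Z2)) (s : seq Z2) : F !=set0 ->
  total_on F subset -> {in s, forall y, (\bigcup_(A in F) A) y} ->
  exists2 A, F A & {in s, forall y, A y}.
Proof.
move=> [A0 FA0] totF; elim: s => [|z s IH] Fs; first by exists A0.
have [y ys|A FA As] := IH; first by apply: Fs; rewrite inE ys orbT.
have [B FB Bz] : (\bigcup_(A in F) A) z by apply: Fs; rewrite inE eqxx.
have [AB|BA] := totF A B FA FB.
- by exists B => // y; rewrite inE => /orP[/eqP->//|/As/AB].
- by exists A => // y; rewrite inE => /orP[/eqP->|/As//]; exact: BA.
Qed.

Lemma rule_closed_bigcup (Q : set (seq Z2)) (F : set (set Z2)) : F !=set0 ->
  total_on F subset -> (forall A, F A -> rule_closed Q A) ->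
  rule_closed Q (\bigcup_(A in F) A).
Proof.
move=> F0 totF clF s x Qs xs Fy.
have [y|A FA As] := @chain_seq F [seq y <- s | y != x] F0 totF.
  by rewrite mem_filter => /andP[yx ys]; exact: Fy.
exists A => //; apply: (clF A FA s x Qs xs) => y ys yx.
by apply: As; rewrite mem_filter yx.
Qed.

(** The finite sequence [G] keeps chain unions proper: if a union were everything, a single member
    would contain [G] and be everything already. *)
Lemma exists_maximal_closed (Q : set (seq Z2)) (G : seq Z2) (S : set Z2) :
  (forall A, rule_closed Q A -> {in G, forall y, A y} -> A = setT) ->
  rule_closed Q S -> S `<` setT ->
  exists2 S', maximal_set (rule_closed Q) S' & S `<=` S'.
Proof.
move=> genG clS /proper_setT ST.
(* The condition bears on the union with [S] instead of on sets containing [S], so that the union of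
   the empty chain satisfies it too. *)
pose P : set (set Z2) := [set A | rule_closed Q (A `|` S) /\ A `|` S <> setT].
have [F FP totF|A [[clA AT] Amax]] := @Zorn_bigcup _ P.
  have [->|/set0P[A0 FA0]] := eqVneq F set0.
    by rewrite /P bigcup_set0 /= set0U.
  pose F' := [set A `|` S | A in F].
  have F'0 : F' !=set0 by exists (A0 `|` S), A0.
  have totF' : total_on F' subset.
    move=> _ _ [A FA <-] [B FB <-].
    by have [AB|BA] := totF A B FA FB; [left|right]; exact: setSU.
  have E : \bigcup_(A in F) A `|` S = \bigcup_(A in F') A.
    apply/seteqP; split=> x.
      case=> [[A FA Ax]|Sx]; first by exists (A `|` S); [exists A|left].
      by exists (A0 `|` S); [exists A0|right].
    by move=> [_ [A FA <-]] [Ax|Sx]; [left; exists A|right].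
  rewrite /P /= E; split.
    by apply: rule_closed_bigcup => // _ [A /FP[clA _] <-].
  move=> UT; have [y _|_ [A /FP[clA AT] <-] As] := @chain_seq F' G F'0 totF'.
    by rewrite UT.
  exact/AT/(genG _ clA).
exists (A `|` S); last exact: subsetUr.
split=> //; first exact/proper_setT.
move=> B clB /proper_setT BT [AB nBA]; apply: (Amax B).
  by split=> [x Ax|BA]; [apply: AB; left|apply: nBA => x /BA; left].
have -> : P B = (rule_closed Q B /\ B <> setT); last by [].
by rewrite /P /= (_ : B `|` S = B) //; apply/setUidPl => x Sx; apply: AB; right.
Qed.

(* The points [(r, r (r + 1) / 2)] with [-3 <= r <= 2]. *)
Definition generators : seq Z2 :=
  [:: (-3, 3); (-2, 1); (-1, 0); (0, 0); (1, 1); (2, 3)].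

Lemma bclosed_generators (S : set Z2) : rule_closed (quads bquad) S ->
  {in generators, forall y, S y} -> S = setT.
Proof.
move=> clS SG.
(* The generators of abscissas 0, 1 and 2 form a unimodular triangle. *)
by apply: (@bclosed_setT S (0, 0) (1, 1) (2, 3)) => //; exact: SG.
Qed.

(** Evaluation produces [delta0] and one point in each of the three other translates of
    [J_quarter]. *)
Lemma iclosed_generators (S : set Z2) : rule_closed (quads iquad) S ->
  {in generators, forall y, S y} -> S = setT.
Proof.
move=> clS SG.
have SD : {in delta0, forall y, S y}.
  by apply: (@closure_sub generators _ _ _ clS SG); vm_compute.
have ST : {in half_periods, forall y, S y}.
  by apply: (@closure_sub generators _ _ _ clS SG); vm_compute.
apply/seteqP; split=> // q _.
have [|[t tT qJ]] := inJ_cover q; first exact: (inJ_sub clS SD).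
by apply: (@inJ_translate_sub S t t q clS SD tT) => //; [rewrite subrr|exact: ST].
Qed.

(** * Non-periodic maximal sets from a sparse parabola *)

Lemma aff_inj (p u v : Z2) : unimod u v -> injective (aff p u v).
Proof.
move=> /unimod_sqr e a b ab; have [ab1 ab2] := (congr1 fst ab, congr1 snd ab).
case: p u v a b e ab1 ab2 {ab} => [p1 p2] [u1 u2] [v1 v2] [a1 a2] [b1 b2].
rewrite /det /= => e ab1 ab2; set d := u1 * v2 - u2 * v1 in e.
have h1 : d * (a1 - b1) = 0.
  have -> : d * (a1 - b1) =
    (p1 + a1 * u1 + a2 * v1 - (p1 + b1 * u1 + b2 * v1)) * v2 -
    (p2 + a1 * u2 + a2 * v2 - (p2 + b1 * u2 + b2 * v2)) * v1 by rewrite /d; ring.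
  by rewrite ab1 ab2 !subrr !mul0r subrr.
have h2 : d * (a2 - b2) = 0.
  have -> : d * (a2 - b2) =
    (p2 + a1 * u2 + a2 * v2 - (p2 + b1 * u2 + b2 * v2)) * u1 -
    (p1 + a1 * u1 + a2 * v1 - (p1 + b1 * u1 + b2 * v1)) * u2 by rewrite /d; ring.
  by rewrite ab1 ab2 !subrr !mul0r subrr.
have d0 : d != 0 by apply: contra_eq_neq e => ->; rewrite mul0r.
by move: h1 h2 => /eqP + /eqP; rewrite !mulf_eq0 !(negbTE d0) !subr_eq0
  => /eqP-> /eqP->.
Qed.

Lemma bquadE (p u v : Z2) :
  bquad p u v = map (aff p u v) [:: (0, 0); (1, 0); (-1, 0); (0, 1)].
Proof.
by rewrite /= /bquad /aff; congr [:: _; _; _; _]; apply: eqZ2 => /=; ring.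
Qed.

Lemma iquadE (p u v : Z2) : iquad p u v = map (aff p u v) delta0.
Proof.
by rewrite /= /iquad /aff; congr [:: _; _; _; _]; apply: eqZ2 => /=; ring.
Qed.

Lemma bquad_uniq (p u v : Z2) : unimod u v -> uniq (bquad p u v).
Proof. by move=> uv; rewrite bquadE map_inj_uniq //; exact: aff_inj. Qed.

Lemma iquad_uniq (p u v : Z2) : unimod u v -> uniq (iquad p u v).
Proof. by move=> uv; rewrite iquadE map_inj_uniq //; exact: aff_inj. Qed.

(** Abscissas are even from 0 upwards and odd from -3 downwards. The change of parity keeps all gaps
    at least 2 while every residue class modulo an even number is met. *)
Definition sparse_parabola : set Z2 :=
  [set q | (exists m : int, 0 <= m /\ q.1 = 2 * m \/ m < 0 /\ q.1 = 2 * m - 1) /\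
           2 * q.2 = q.1 * (q.1 + 1)].

(** A Vandermonde determinant: twice the determinant is, up to sign, the product of the three
    differences of abscissas, each at least 2 in absolute value. *)
Lemma sparse_parabola_det (a b c : Z2) : sparse_parabola a ->
  sparse_parabola b -> sparse_parabola c -> uniq [:: a; b; c] ->
  4 <= `|det (b - a) (c - a)|.
Proof.
have gap x y : sparse_parabola x -> sparse_parabola y -> x != y ->
    2 <= `|x.1 - y.1|.
  case: x y => [x1 x2] [y1 y2] [/= [m mx] x2E] [[/= n ny] y2E] xy.
  have xy1 : x1 != y1.
    apply: contra_neq xy => E; congr pair => //.
    by apply: (@mulfI _ (2 : int)) => //; rewrite x2E y2E E.
  by lia.
move=> Sa Sb Sc /=; rewrite !inE negb_or andbT => /andP[/andP[ab ac] bc].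
have gab := gap _ _ Sa Sb ab; have gac := gap _ _ Sa Sc ac.
have gbc := gap _ _ Sb Sc bc.
have E : 2 * det (b - a) (c - a) = (a.1 - b.1) * (a.1 - c.1) * (c.1 - b.1).
  case: a b c Sa Sb Sc {ab ac bc gab gac gbc} => [a1 a2] [b1 b2] [c1 c2].
  move=> [_ /= Ea] [_ /= Eb] [_ /= Ec]; rewrite /det /=.
  transitivity ((b1 - a1) * (2 * c2 - 2 * a2) - (2 * b2 - 2 * a2) * (c1 - a1)).
    ring.
  rewrite Ea Eb Ec; ring.
have : 8 <= `|2 * det (b - a) (c - a)|.
  rewrite E !normrM [`|c.1 - b.1|]distrC -[8]/((2 * 2) * 2 : int).
  by do 2?apply: ler_pM.
by rewrite normrM; lia.
Qed.

Lemma sparse_parabola_quad (a b c d x : Z2) : uniq [:: a; b; c; d] ->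
  `|det (c - b) (d - b)| <= 3 -> `|det (c - a) (d - a)| <= 3 ->
  `|det (b - a) (d - a)| <= 3 -> `|det (b - a) (c - a)| <= 3 ->
  x \in [:: a; b; c; d] ->
  ~ (forall y, y \in [:: a; b; c; d] -> y != x -> sparse_parabola y).
Proof.
rewrite /= !inE !negb_or andbT => /and3P[/and3P[ab ac ad] /andP[bc bd] cd].
move=> bcd acd abd abc xE Sy.
have no3 (p q r : Z2) : p \in [:: a; b; c; d] -> q \in [:: a; b; c; d] ->
    r \in [:: a; b; c; d] -> p != x -> q != x -> r != x -> uniq [:: p; q; r] ->
    `|det (q - p) (r - p)| <= 3 -> False.
  move=> ps qs rs px qx rx u3.
  by apply/negP; rewrite -ltNge; apply: lt_le_trans (sparse_parabola_det
    (Sy p ps px) (Sy q qs qx) (Sy r rs rx) u3).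
case/or4P: xE => /eqP xE; [apply: (no3 b c d)|apply: (no3 a c d)|
    apply: (no3 a b d)|apply: (no3 a b c)] => //;
  by rewrite /= ?inE ?xE ?negb_or ?eqxx ?orbT ?ab ?ac ?ad ?bc ?bd ?cd //
    1?eq_sym ?ab ?ac ?ad ?bc ?bd ?cd.
Qed.

(** The premise of the rule never holds: three points of a quadruple have determinant at most 2
    (border) or 3 (internal) in absolute value, below the bound 4. *)
Lemma sparse_parabola_closed (Q : set (seq Z2)) :
  Q `<=` quads bquad `|` quads iquad -> rule_closed Q sparse_parabola.
Proof.
move=> QQ s x /QQ[] [p [u [v [uv ->]]]] xs Sy; exfalso.
- apply: (sparse_parabola_quad (bquad_uniq p uv) _ _ _ _ xs Sy).
  + rewrite (_ : det _ _ = - 2 * det u v); last by rewrite /det /=; ring.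
    by rewrite normrM (eqP uv).
  + rewrite (_ : det _ _ = - det u v); last by rewrite /det /=; ring.
    by rewrite normrN (eqP uv).
  + rewrite (_ : det _ _ = det u v); last by rewrite /det /=; ring.
    by rewrite (eqP uv).
  + by rewrite (_ : det _ _ = 0) ?normr0 // /det /=; ring.
- apply: (sparse_parabola_quad (iquad_uniq p uv) _ _ _ _ xs Sy).
  + rewrite (_ : det _ _ = 3 * det u v); last by rewrite /det /=; ring.
    by rewrite normrM (eqP uv).
  + rewrite (_ : det _ _ = det u v); last by rewrite /det /=; ring.
    by rewrite (eqP uv).
  + rewrite (_ : det _ _ = - det u v); last by rewrite /det /=; ring.
    by rewrite normrN (eqP uv).
  + rewrite (_ : det _ _ = det u v); last by rewrite /det /=; ring.
    by rewrite (eqP uv).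
Qed.

Lemma sparse_parabola_proper : sparse_parabola `<` setT.
Proof.
apply/proper_setT => ST.
by have [_ /=] : sparse_parabola (0, 1) by rewrite ST.
Qed.

Lemma mulrnZ2 (v : Z2) (k : nat) : v *+ k = (v.1 * k%:Z, v.2 * k%:Z).
Proof.
elim: k => [|k IH]; first by rewrite mulr0n !mulr0.
by rewrite mulrS IH; apply: eqZ2 => /=; rewrite intS; ring.
Qed.

(* Modulo [k] the point of abscissa [r] on the parabola is the one of abscissa
   [r + 2 k m], which is on the sparse parabola for a suitable [m]. *)
Lemma periodic_generators (S : set Z2) : sparse_parabola `<=` S ->
  periodic_set S -> {in generators, forall y, S y}.
Proof.
move=> subS [X [k [_ k0 SE]]].
have Sk q w : S q -> S (q + w *+ k).
  rewrite SE => -[x Xx [_ [v _ <-] <-]]; exists x => //.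
  exists ((v + w) *+ k); first by exists (v + w).
  by rewrite mulrnDl addrA.
have par (r y m : int) : 2 * y = r * (r + 1) ->
    (exists n : int, 0 <= n /\ r + 2 * k%:Z * m = 2 * n \/
                     n < 0 /\ r + 2 * k%:Z * m = 2 * n - 1) -> S (r, y).
  (* [h * k] is the increment of [r (r + 1) / 2] when [r] grows by [2 k m], so both coordinates move
     by multiples of [k]. *)
  move=> yE rX; pose h := m * (2 * r + 1) + 2 * k%:Z * m * m.
  have -> : (r, y) = (r + 2 * k%:Z * m, y + h * k%:Z) + (- 2 * m, - h) *+ k.
    by rewrite mulrnZ2; apply: eqZ2 => /=; ring.
  apply/Sk/subS; split=> //=; rewrite mulrDr yE /h; ring.
move=> y; rewrite !inE => /orP[|/orP[|/or4P[]]] /eqP->.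
- by apply: (par _ _ 0) => //; exists (-1); lia.
- by apply: (par _ _ 1) => //; exists (k%:Z - 1); lia.
- by apply: (par _ _ (-1)) => //; exists (- k%:Z); lia.
- by apply: (par _ _ 0) => //; exists 0; lia.
(* The shift by [-2 k] would not do here: for [k = 1] it leads to abscissa -1, which the sparse
   parabola omits. *)
- by apply: (par _ _ (-2)) => //; exists (1 - 2 * k%:Z); lia.
- by apply: (par _ _ 0) => //; exists 1; lia.
Qed.

Lemma exists_nonperiodic_maximal (Q : set (seq Z2)) :
  Q `<=` quads bquad `|` quads iquad ->
  (forall A, rule_closed Q A -> {in generators, forall y, A y} -> A = setT) ->
  exists2 S, maximal_set (rule_closed Q) S & ~ periodic_set S.
Proof.
move=> QQ genQ; have [S maxS subS] := exists_maximal_closed genQ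
  (sparse_parabola_closed QQ) sparse_parabola_proper.
exists S => // perS; case: maxS => clS /proper_setT ST _.
by apply/ST/(genQ _ clS); exact: periodic_generators.
Qed.

(** * Lattice points of triangles *)

Section Geometry.
Variable R : realType.

(** Twice the signed area, over a general ring so that one formula serves both integers and
    reals. *)
Definition area (K : comNzRingType) (a b c : K * K) : K :=
  (b.1 - a.1) * (c.2 - a.2) - (b.2 - a.2) * (c.1 - a.1).

Lemma area_toplane (a b c : Z2) :
  area (toplane R a) (toplane R b) (toplane R c) = (area a b c)%:~R.
Proof. by rewrite /area /= -!rmorphB -!rmorphM -rmorphB. Qed.

(** Barycentric coordinates are quotients of areas. Products with the total area have the same signs
    as these quotients and avoid both division and a choice of orientation. *)
Lemma hull3P (a b c x : R * R) : area a b c != 0 ->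
  hull3 a b c x <-> [/\ 0 <= area x b c * area a b c,
                        0 <= area a x c * area a b c &
                        0 <= area a b x * area a b c].
Proof.
move=> D0; have DD : 0 < area a b c * area a b c by rewrite -expr2 exprn_even_gt0.
split.
- move=> [r [s [t [r0 s0 t0 rst ->]]]].
  have {}rst : r = 1 - s - t by lra.
  split; [rewrite (_ : area _ _ _ = r * area a b c)|
          rewrite (_ : area _ _ _ = s * area a b c)|
          rewrite (_ : area _ _ _ = t * area a b c)];
    by [rewrite -mulrA; apply: mulr_ge0 => //; exact: ltW |
        rewrite rst /area /= /GRing.scale /=; ring].
- move=> [h1 h2 h3].
  have div (y : R) : 0 <= y * area a b c -> 0 <= y / area a b c.
    move=> h; rewrite (_ : y / _ = y * area a b c / (area a b c * area a b c)).
      by apply: divr_ge0 => //; exact: ltW.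
    by field.
  exists (area x b c / area a b c), (area a x c / area a b c),
    (area a b x / area a b c); split; try exact: div.
  + by rewrite -!mulrDl (_ : _ + _ = area a b c) ?divff // /area; ring.
  + case: a b c x D0 {DD h1 h2 h3 div} => [a1 a2] [b1 b2] [c1 c2] [x1 x2].
    rewrite /area /= => D0.
    by apply: injective_projections; rewrite /= /GRing.scale /=; field.
Qed.

(** If [a] and [b] differ, [b - a] directs the line and a coordinate where they differ gives the
    parameter of [c]; if they coincide, [c - a] serves as direction. *)
Lemma collinearP (a b c : R * R) : collinear a b c <-> area a b c = 0.
Proof.
split.
- move=> [z [d abc]].
  have [t1 _ <-] : [set z + t *: d | t in [set: R]] a by apply: abc; left; left.
  have [t2 _ <-] : [set z + t *: d | t in [set: R]] b by apply: abc; left; right.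
  have [t3 _ <-] : [set z + t *: d | t in [set: R]] c by apply: abc; right.
  by rewrite /area /= /GRing.scale /=; ring.
- case: a b c => [a1 a2] [b1 b2] [c1 c2]; rewrite /area /= => A.
  have [E1|n1] := eqVneq a1 b1; last first.
    exists (a1, a2), (b1 - a1, b2 - a2) => _ [[->|->]|->].
    + by exists 0 => //; rewrite scale0r addr0.
    + by exists 1 => //; apply: injective_projections; rewrite /= /GRing.scale /=; ring.
    + have n0 : b1 - a1 != 0 by rewrite subr_eq0 eq_sym.
      exists ((c1 - a1) / (b1 - a1)) => //.
      apply: injective_projections; rewrite /= /GRing.scale /=; first by field.
      apply: (mulfI n0).
      have -> : (b1 - a1) * (a2 + (c1 - a1) / (b1 - a1) * (b2 - a2)) =
        (b1 - a1) * a2 + (c1 - a1) * (b2 - a2) by field.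
      by move: A; lra.
  have [E2|n2] := eqVneq a2 b2; last first.
    exists (a1, a2), (b1 - a1, b2 - a2) => _ [[->|->]|->].
    + by exists 0 => //; rewrite scale0r addr0.
    + by exists 1 => //; apply: injective_projections; rewrite /= /GRing.scale /=; ring.
    + have n0 : b2 - a2 != 0 by rewrite subr_eq0 eq_sym.
      exists ((c2 - a2) / (b2 - a2)) => //.
      apply: injective_projections; rewrite /= /GRing.scale /=; last by field.
      apply: (mulfI n0).
      have -> : (b2 - a2) * (a1 + (c2 - a2) / (b2 - a2) * (b1 - a1)) =
        (b2 - a2) * a1 + (c2 - a2) * (b1 - a1) by field.
      by move: A; lra.
  exists (a1, a2), (c1 - a1, c2 - a2) => _ [[->|->]|->].
  + by exists 0 => //; rewrite scale0r addr0.
  + by exists 0 => //; rewrite scale0r addr0 E1 E2.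
  + by exists 1 => //; apply: injective_projections; rewrite /= /GRing.scale /=; ring.
Qed.

Lemma area_pair_cvg (T : Type) (F : set_system T) {FF : Filter F}
    (f g h : T -> R * R) (a b c : R * R) :
  f @ F --> a -> g @ F --> b -> h @ F --> c ->
  area (f t) (g t) (h t) @[t --> F] --> area a b c.
Proof.
move=> fa gb hc.
have c1 (k : T -> R * R) (z : R * R) : k @ F --> z -> (k t).1 @[t --> F] --> z.1.
  by move=> kz; apply: (cvg_comp _ _ kz); exact: cvg_fst.
have c2 (k : T -> R * R) (z : R * R) : k @ F --> z -> (k t).2 @[t --> F] --> z.2.
  by move=> kz; apply: (cvg_comp _ _ kz); exact: cvg_snd.
by apply: cvgB; apply: cvgM; apply: cvgB; (exact: c1 || exact: c2).
Qed.

(** An interior point can be pushed slightly away from each vertex inside the triangle, which makes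
    the matching coordinate strictly positive. Conversely, strict inequalities between continuous
    functions are open conditions. *)
Lemma interior_hull3P (a b c x : R * R) : area a b c != 0 ->
  (hull3 a b c)° x <-> [/\ 0 < area x b c * area a b c,
                        0 < area a x c * area a b c &
                        0 < area a b x * area a b c].
Proof.
move=> D0; have DD : 0 < area a b c * area a b c by rewrite -expr2 exprn_even_gt0.
split.
- move=> xint.
  have pull (p : R * R) : exists2 t : R, 0 < t & hull3 a b c (x + t *: (x - p)).
    have : (fun t : R => x + t *: (x - p)) @ (0 : R) --> x + (0 : R) *: (x - p).
      by apply: cvgD; [exact: cvg_cst|apply: cvgZr_tmp; exact: cvg_id].
    rewrite scale0r addr0 => /(_ _ xint) /nbhs_ballP[e /= e0 He].
    exists (e / 2); first exact: divr_gt0.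
    apply: He; rewrite /ball /= sub0r normrN gtr0_norm ?divr_gt0 //.
    by rewrite ltr_pdivrMr // ltr_pMr // ltr1n.
  (* With [D] the total area, the push away from a vertex changes the area [X] opposite to it into
     [(1 + t) X - t D]. *)
  have strict (X t : R) : 0 < t ->
      0 <= ((1 + t) * X - t * area a b c) * area a b c -> 0 < X * area a b c.
    move=> t0; rewrite mulrBl -!mulrA subr_ge0 => h.
    have : 0 < (1 + t) * (X * area a b c).
      by apply: lt_le_trans h; exact: mulr_gt0.
    by rewrite pmulr_rgt0 // addr_gt0.
  split.
  + have [t t0 /hull3P[] // h _ _] := pull a; apply: (strict _ t) => //.
    by congr (0 <= _ * _) : h; rewrite /area /= /GRing.scale /=; ring.
  + have [t t0 /hull3P[] // _ h _] := pull b; apply: (strict _ t) => //.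
    by congr (0 <= _ * _) : h; rewrite /area /= /GRing.scale /=; ring.
  + have [t t0 /hull3P[] // _ _ h] := pull c; apply: (strict _ t) => //.
    by congr (0 <= _ * _) : h; rewrite /area /= /GRing.scale /=; ring.
- move=> [h1 h2 h3]; rewrite /interior.
  have pos (f : R * R -> R) : f @ x --> f x -> 0 < f x * area a b c ->
      \forall y \near x, 0 < f y * area a b c.
    by move=> fx; apply: (cvgr_gt _ (cvgMr_tmp (b := area a b c) fx)).
  near=> y; apply/hull3P => //; split; apply: ltW; near: y; apply: pos => //;
    by apply: area_pair_cvg; (exact: cvg_id || exact: cvg_cst).
Unshelve. all: by end_near.
Qed.

End Geometry.

(** * Lattice triangles with at most one lattice point besides the vertices *)

Definition intri (a b c q : Z2) : bool :=
  [&& 0 <= area q b c * area a b c, 0 <= area a q c * area a b c &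
      0 <= area a b q * area a b c].

Lemma area_rot (a b c : Z2) : area b c a = area a b c.
Proof. by rewrite /area; ring. Qed.

Lemma area_swap (a b c : Z2) : area a c b = - area a b c.
Proof. by rewrite /area; ring. Qed.

Lemma intri_rot (a b c q : Z2) : intri b c a q = intri a b c q.
Proof.
rewrite /intri (area_rot a q c) (area_rot a b q) (area_rot q b c) (area_rot a b c).
by rewrite andbA andbC.
Qed.

Lemma intri_swap (a b c q : Z2) : intri a c b q = intri a b c q.
Proof.
rewrite /intri (area_swap q b c) (area_swap a b c) (area_swap a b q).
by rewrite (area_swap a q c) !mulrNN; congr andb; exact: andbC.
Qed.

Lemma area_eq0 (a b c p : Z2) : area a b c != 0 ->
  area a p c = 0 -> area a b p = 0 -> p = a.
Proof.
move=> D0 apc abp; apply: eqZ2; apply: (mulfI D0); apply/eqP; rewrite -subr_eq0.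
- have -> : area a b c * p.1 - area a b c * a.1 =
    area a p c * (b.1 - a.1) + area a b p * (c.1 - a.1) by rewrite /area; ring.
  by rewrite apc abp !mul0r addr0.
- have -> : area a b c * p.2 - area a b c * a.2 =
    area a p c * (b.2 - a.2) + area a b p * (c.2 - a.2) by rewrite /area; ring.
  by rewrite apc abp !mul0r addr0.
Qed.

(* If the area exceeds 1, some lattice point lies in the half-open fundamental
   parallelogram; it or its image under the central symmetry of the
   parallelogram lies in the triangle. *)
Lemma empty_triangle (a b c : Z2) : area a b c != 0 ->
  (forall q, intri a b c q -> q \in [:: a; b; c]) -> `|area a b c| == 1.
Proof.
wlog D0 : b c / 0 < area a b c.
  move=> wl Dn0 emp; case: (ltrgtP (area a b c) 0) Dn0 => // [Dl|Dg] _.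
    rewrite -normrN -area_swap; apply: wl; rewrite 1?area_swap ?oppr_gt0 //.
      by rewrite oppr_eq0 lt_eqF.
    move=> q; rewrite intri_swap => /emp; rewrite !inE.
    by case/or3P=> ->; rewrite ?orbT.
  by apply: wl => //; rewrite gt_eqF.
move=> Dn0 emp; apply: contraT => Dn1.
pose u := b - a; pose v := c - a; pose D := area a b c.
have DE : det u v = D by rewrite /det /u /v /D /area /=.
(* Otherwise, testing the two unit vectors, [D] would divide all coordinates of [u] and [v], and
   [D * D] would divide [D]. *)
have [y hy] : exists y : Z2, ~~ ((D %| det y v)%Z && (D %| det u y)%Z).
  apply: contrapT => /forallNP h.
  have {}h y : (D %| det y v)%Z && (D %| det u y)%Z by apply: contraT => /h.
  have /andP[d1 d2] := h (1, 0); have /andP[d3 d4] := h (0, 1).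
  have {}d1 : (D %| v.2)%Z by move: d1; rewrite /det /= mul1r mul0r subr0.
  have {}d2 : (D %| u.2)%Z by move: d2; rewrite /det /= mulr0 mulr1 sub0r rpredN.
  have {}d3 : (D %| v.1)%Z by move: d3; rewrite /det /= mul1r mul0r sub0r rpredN.
  have {}d4 : (D %| u.1)%Z by move: d4; rewrite /det /= mulr0 mulr1 subr0.
  have : (D * D %| D)%Z.
    by rewrite -[X in (_ %| X)%Z]DE /det rpredB //; exact: dvdz_mul.
  rewrite -[X in (_ %| X)%Z]mulr1 dvdz_mul2l ?gt_eqF // dvdz1 => D1.
  by move: Dn1 D1; rewrite -/D; clear; lia.
pose i := (det y v %/ D)%Z; pose j := (det u y %/ D)%Z.
pose al := (det y v %% D)%Z; pose be := (det u y %% D)%Z.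
have [al0 be0] : 0 <= al /\ 0 <= be by rewrite !modz_ge0 ?gt_eqF.
have [alD beD] : al < D /\ be < D by rewrite !ltz_pmod.
have ab0 : ~ (al = 0 /\ be = 0).
  by move=> [/dvdz_mod0P h1 /dvdz_mod0P h2]; move: hy; rewrite h1 h2.
(* [x] is [y] reduced into the parallelogram; its coordinates along [u] and [v], scaled by [D], are
   the remainders [al] and [be]. *)
pose x : Z2 := (y.1 - i * u.1 - j * v.1, y.2 - i * u.2 - j * v.2).
have xv : det x v = al.
  rewrite /al -(addrK (i * D) (det y v %% D)%Z) addrC.
  rewrite [X in _ = - _ + X](_ : _ = det y v); last by rewrite addrC -divz_eq.
  by rewrite -DE /det /x /=; ring.
have ux : det u x = be.
  rewrite /be -(addrK (j * D) (det u y %% D)%Z) addrC.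
  rewrite [X in _ = - _ + X](_ : _ = det u y); last by rewrite addrC -divz_eq.
  by rewrite -DE /det /x /=; ring.
clearbody al be x.
have aac : area a a c = 0 by rewrite /area; ring.
have acc : area a c c = 0 by rewrite /area; ring.
have aba : area a b a = 0 by rewrite /area; ring.
have abb : area a b b = 0 by rewrite /area; ring.
have [abD|abD] := lerP (al + be) D.
- have q2 : area a (a + x) c = al by rewrite -xv /det /v /area /=; ring.
  have q3 : area a b (a + x) = be by rewrite -ux /det /u /area /=; ring.
  have q1 : area (a + x) b c = D - al - be.
    by rewrite -q2 -q3 /D /area /=; ring.
  have : a + x \in [:: a; b; c].
    apply: emp; rewrite /intri q1 q2 q3 -/D.
    by apply/and3P; split; apply: mulr_ge0; lia.
  rewrite !inE => /or3P[]/eqP E; move: q2 q3; rewrite E -/D ?aac ?acc ?aba ?abb; lia.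
- pose z := a + u + v - x.
  have q2 : area a z c = D - al by rewrite -xv -DE /det /z /u /v /area /=; ring.
  have q3 : area a b z = D - be by rewrite -ux -DE /det /z /u /v /area /=; ring.
  have q1 : area z b c = al + be - D.
    have -> : area z b c = D - area a z c - area a b z.
      by rewrite /D /area /=; ring.
    by rewrite q2 q3; lia.
  have : z \in [:: a; b; c].
    apply: emp; rewrite /intri q1 q2 q3 -/D.
    by apply/and3P; split; apply: mulr_ge0; lia.
  rewrite !inE => /or3P[]/eqP E; move: q2 q3; rewrite E -/D ?aac ?acc ?aba ?abb; lia.
Qed.

(** The coordinates of [q] in [a b c] combine its coordinates in [p b c] with those of [p], with
    nonnegative weights. The square of [area p b c] clears denominators. *)
Lemma intri_trans (a b c p q : Z2) : area p b c != 0 ->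
  intri a b c p -> intri p b c q -> intri a b c q.
Proof.
move=> al0 /and3P[p1 p2 p3] /and3P[q1 q2 q3].
have al2 : 0 < area p b c * area p b c by rewrite -expr2 exprn_even_gt0.
apply/and3P; split; rewrite -(pmulr_rge0 _ al2).
- have -> : area p b c * area p b c * (area q b c * area a b c) =
    (area q b c * area p b c) * (area p b c * area a b c) by ring.
  exact: mulr_ge0.
- have -> : area p b c * area p b c * (area a q c * area a b c) =
    (area q b c * area p b c) * (area a p c * area a b c) +
    (area p q c * area p b c) * (area a b c * area a b c).
    have -> : area p b c * area p b c * (area a q c * area a b c) =
      area p b c * area a b c * (area p b c * area a q c) by ring.
    have -> : area p b c * area a q c =
       area q b c * area a p c + area p q c * area a b c by rewrite /area; ring.
    by ring.
  by apply: addr_ge0; apply: mulr_ge0 => //; rewrite -expr2 sqr_ge0.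
- have -> : area p b c * area p b c * (area a b q * area a b c) =
    (area q b c * area p b c) * (area a b p * area a b c) +
    (area p b q * area p b c) * (area a b c * area a b c).
    have -> : area p b c * area p b c * (area a b q * area a b c) =
      area p b c * area a b c * (area p b c * area a b q) by ring.
    have -> : area p b c * area a b q =
       area q b c * area a b p + area p b q * area a b c by rewrite /area; ring.
    by ring.
  by apply: addr_ge0; apply: mulr_ge0 => //; rewrite -expr2 sqr_ge0.
Qed.

(** The only lattice point besides its vertices that [p b c] could contain is [a]; but [p] in
    [a b c] and [a] in [p b c] together force [p = a]. So [empty_triangle] applies. *)
Lemma minimal_subtriangle (a b c p : Z2) : area a b c != 0 ->
  (forall q, intri a b c q -> q \in [:: a; b; c; p]) -> intri a b c p ->
  p != a -> area p b c != 0 -> `|area p b c| == 1.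
Proof.
move=> D0 emp pin pa al0; apply: empty_triangle => // q qin.
have : q \in [:: a; b; c; p] by apply/emp/(intri_trans al0 pin qin).
rewrite !inE => /or4P[]/eqP E; try by rewrite E eqxx ?orbT.
case/and3P: pin qin => al1 be1 ga1 /and3P[_]; rewrite E.
have -> : area p a c = - area a p c by rewrite /area; ring.
have -> : area p b a = - area a b p by rewrite /area; ring.
have D2 : 0 < area a b c * area a b c by rewrite -expr2 exprn_even_gt0.
have vanish x : 0 <= x * area a b c -> 0 <= - x * area p b c -> x = 0.
  move=> x1 x2; apply/eqP; rewrite -(mulIr_eq0 _ (mulIf al0)) eq_le.
  rewrite -oppr_ge0 -mulNr x2 -(pmulr_rge0 _ D2).
  have -> : area a b c * area a b c * (x * area p b c) =
    (x * area a b c) * (area p b c * area a b c) by ring.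
  exact: mulr_ge0.
by move=> /(vanish _ be1) be0 /(vanish _ ga1) ga0; rewrite (area_eq0 D0 be0 ga0) eqxx in pa.
Qed.

(** With [p] on the side [a b], the triangles [p b c] and [p a c] both have area form 1 in absolute
    value, which makes [p] the midpoint of [a b]. *)
Lemma border_form (a b c p : Z2) : area a b c != 0 ->
  (forall q, intri a b c q -> q \in [:: a; b; c; p]) -> intri a b c p ->
  p \notin [:: a; b; c] -> area a b p = 0 ->
  exists u v, unimod u v /\ [:: a; b; c; p] =i bquad p u v.
Proof.
move=> D0 emp pin; rewrite !inE !negb_or => /and3P[pa pb pc] ga0.
have Dsum : area a b c = area p b c + area a p c by
  rewrite -[RHS]addr0 -ga0 /area; ring.
have al0 : area p b c != 0.
  apply: contra_neq pb => al0; apply: (@area_eq0 b c a p).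
  - by rewrite area_rot.
  - by rewrite -ga0 /area; ring.
  - by rewrite area_rot.
have be0 : area p a c != 0.
  apply: contra_neq pa => be0; apply: (@area_eq0 a b c p) => //.
  by rewrite -[RHS]oppr0 -be0 /area; ring.
have al1 := minimal_subtriangle D0 emp pin pa al0.
have intriE q : intri b a c q = intri a b c q by rewrite -intri_swap intri_rot.
have be1 : `|area p a c| == 1.
  apply: (@minimal_subtriangle b a c p) => //.
  - by rewrite (_ : area b a c = - area a b c) ?oppr_eq0 // /area; ring.
  - move=> q; rewrite intriE => /emp; rewrite !inE.
    by case/or4P=> ->; rewrite ?orbT.
  - by rewrite intriE.
(* Both values are 1 or -1 and their difference is, up to sign, the nonzero [area a b c]. *)
have beE : area p a c = - area p b c.
  have E : area a p c = - area p a c by rewrite /area; ring.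
  case/and3P: pin => h1 h2 _; move: h1 h2; rewrite Dsum E.
  move: al1 be1 D0; rewrite Dsum E; move: (area p b c) (area p a c) => x y.
  have sgn (w : int) : `|w| == 1 -> w = 1 \/ w = -1 by lia.
  by move=> /sgn[]-> /sgn[]->.
exists (b - p), (c - p); split.
  by rewrite /unimod (_ : det _ _ = area p b c) // /det /area /=; ring.
have aE : p - (b - p) = a.
  have E : a + b - p = p; last by rewrite -{1}E opprB addrA addrNK addrK.
  apply: (@area_eq0 p b c) => //.
  - have -> : area p (a + b - p) c = area p a c + area p b c by rewrite /area /=; ring.
    by rewrite beE addNr.
  - by rewrite -[RHS]oppr0 -ga0 /area /=; ring.
by move=> q; rewrite !inE aE ![p + (_ - p)]addrC !subrK; case: (q == a);
  case: (q == b); case: (q == c); case: (q == p).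
Qed.

(** The three triangles joining [p] to the sides have area form 1 in absolute value and the same
    orientation, so [p] is the centroid. *)
Lemma internal_form (a b c p : Z2) : area a b c != 0 ->
  (forall q, intri a b c q -> q \in [:: a; b; c; p]) -> intri a b c p ->
  p \notin [:: a; b; c] -> area p b c != 0 -> area a p c != 0 ->
  area a b p != 0 ->
  exists u v, unimod u v /\ [:: a; b; c; p] =i iquad p u v.
Proof.
move=> D0 emp pin; rewrite !inE !negb_or => /and3P[pa pb pc] al0 be0 ga0.
have al1 := minimal_subtriangle D0 emp pin pa al0.
have be1 : `|area a p c| == 1.
  rewrite -area_rot; apply: (@minimal_subtriangle b c a p) => //; rewrite 1?area_rot //.
  - move=> q; rewrite intri_rot => /emp; rewrite !inE.
    by case/or4P=> ->; rewrite ?orbT.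
  - by rewrite intri_rot.
have ga1 : `|area a b p| == 1.
  rewrite -area_rot -area_rot; apply: (@minimal_subtriangle c a b p) => //.
  - by rewrite area_rot area_rot.
  - move=> q; rewrite intri_rot intri_rot => /emp; rewrite !inE.
    by case/or4P=> ->; rewrite ?orbT.
  - by rewrite intri_rot intri_rot.
  - by rewrite area_rot area_rot.
have Dsum : area a b c = area p b c + area a p c + area a b p by rewrite /area; ring.
have [beE gaE] : area a p c = area p b c /\ area a b p = area p b c.
  case/and3P: pin => h1 h2 h3; move: h1 h2 h3; rewrite Dsum.
  move: al1 be1 ga1; move: (area p b c) (area a p c) (area a b p) => x y z.
  have sgn (w : int) : `|w| == 1 -> w = 1 \/ w = -1 by lia.
  by move=> /sgn[]-> /sgn[]-> /sgn[]->.
exists (a - p), (b - p); split.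
  rewrite /unimod (_ : det _ _ = area a b p) // /det /area /=; ring.
have cE : p - (a - p) - (b - p) = c.
  have E : a + b + c - p - p = p.
    apply: (@area_eq0 p a b); first by rewrite area_rot area_rot.
    - have -> : area p (a + b + c - p - p) b = area a b p - area p b c.
        by rewrite /area /=; ring.
      by rewrite gaE subrr.
    - have -> : area p a (a + b + c - p - p) = area a b p - area a p c.
        by rewrite /area /=; ring.
      by rewrite gaE beE subrr.
  by rewrite -{1}E; apply: eqZ2 => /=; ring.
by move=> q; rewrite !inE cE ![p + (_ - p)]addrC !subrK; case: (q == a);
  case: (q == b); case: (q == c); case: (q == p).
Qed.

(** In the frame the conditions become [j <= 1 + i], [j <= 1 - i] and [0 <= j], whose integer
    solutions are the four points. *)
Lemma intri_bquad (p u v q : Z2) : unimod u v ->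
  intri (p + u) (p - u) (p + v) q = (q \in bquad p u v).
Proof.
move=> uv; have [[i j] <-] := aff_surj p q uv.
have e := unimod_sqr uv.
rewrite bquadE mem_map; last exact: aff_inj.
have DE : area (p + u) (p - u) (p + v) = - 2 * det u v.
  by rewrite /area /det /=; ring.
rewrite /intri DE.
have -> : area (aff p u v (i, j)) (p - u) (p + v) * (- 2 * det u v) =
    2 * (1 + i - j) * (det u v * det u v) by rewrite /area /det /aff /=; ring.
have -> : area (p + u) (aff p u v (i, j)) (p + v) * (- 2 * det u v) =
    2 * (1 - i - j) * (det u v * det u v) by rewrite /area /det /aff /=; ring.
have -> : area (p + u) (p - u) (aff p u v (i, j)) * (- 2 * det u v) =
    4 * j * (det u v * det u v) by rewrite /area /det /aff /=; ring.
by rewrite e !mulr1 !inE !xpair_eqE; clear; lia.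
Qed.

Lemma intri_iquad (p u v q : Z2) : unimod u v ->
  intri (p + u) (p + v) (p - u - v) q = (q \in iquad p u v).
Proof.
move=> uv; have [[i j] <-] := aff_surj p q uv.
have e := unimod_sqr uv.
rewrite iquadE mem_map; last exact: aff_inj.
have DE : area (p + u) (p + v) (p - u - v) = 3 * det u v.
  by rewrite /area /det /=; ring.
rewrite /intri DE.
have -> : area (aff p u v (i, j)) (p + v) (p - u - v) * (3 * det u v) =
    3 * (1 + 2 * i - j) * (det u v * det u v) by rewrite /area /det /aff /=; ring.
have -> : area (p + u) (aff p u v (i, j)) (p - u - v) * (3 * det u v) =
    3 * (1 - i + 2 * j) * (det u v * det u v) by rewrite /area /det /aff /=; ring.
have -> : area (p + u) (p + v) (aff p u v (i, j)) * (3 * det u v) =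
    3 * (1 - i - j) * (det u v * det u v) by rewrite /area /det /aff /=; ring.
by rewrite e !mulr1 !inE !xpair_eqE; clear; lia.
Qed.

(** * From minimal triangles to quadruples *)

Lemma card_eq_seq (s : seq Z2) : uniq s -> ([set` s] #= `I_(size s))%card.
Proof.
elim: s => [_|x s IH /= /andP[xs us]].
  by rewrite set_nil II0 card_eq00.
apply/eq_cardSP; exists x; first by rewrite /= inE eqxx.
rewrite (_ : _ `\ x = [set` s]); first exact: IH.
apply/seteqP; split=> y /=.
  by rewrite inE => -[/orP[/eqP|//]].
move=> ys; split; first by rewrite inE ys orbT.
by move=> yx; rewrite yx (negbTE xs) in ys.
Qed.

Lemma card_eq_seqP (A : set Z2) (n : nat) : (A #= `I_n)%card ->
  exists2 s : seq Z2, uniq s /\ size s = n & A = [set` s].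
Proof.
elim: n A => [|n IH] A.
  by rewrite II0 card_eq0 => /eqP->; exists [::]; rewrite ?set_nil.
move=> /eq_cardSP[x Ax /IH[s [us sn] E]].
have sE y : (y \in s) <-> A y /\ y <> x.
  by change ([set` s] y <-> (A `\ x) y); rewrite E.
exists (x :: s).
  split; last by rewrite /= sn.
  by rewrite /= us andbT; apply/negP => /sE[_].
apply/seteqP; split=> y /=; rewrite inE.
  by move=> Ay; have [//|/eqP yx] := eqVneq y x; apply/orP; right; apply/sE.
by case/orP=> [/eqP->//|/sE[]].
Qed.

Lemma card_eq_seqE (A : set Z2) (s : seq Z2) : (A #= `I_(size s))%card ->
  uniq s -> {in s, forall y, A y} -> A = [set` s].
Proof.
move=> /card_eq_seqP[t [ut st] ->] us sA.
have [_ E] := uniq_min_size us sA (eq_leq st).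
by apply/seteqP; split=> y /=; rewrite E.
Qed.

Lemma card3_quad (s : seq Z2) (S : set Z2) : uniq s -> size s = 4%N ->
  ([set` s] `&` S #= `I_3)%card <->
  exists x, [/\ x \in s, ~ S x & forall y, y \in s -> y != x -> S y].
Proof.
move=> us s4; split.
- move=> /card_eq_seqP[t [ut t3] E].
  have tE y : (y \in t) <-> y \in s /\ S y.
    by change ([set` t] y <-> ([set` s] `&` S) y); rewrite E.
  have [x xs xt] : exists2 x, x \in s & x \notin t.
    apply/allPn/negP => /allP st.
    by have := uniq_leq_size us st; rewrite s4 t3.
  exists x; split=> // [Sx|y ys yx].
    by move/negP: xt; apply; apply/tE.
  apply: contrapT => nSy.
  have yt : y \notin t by apply/negP => /tE[].
  have /uniq_leq_size : uniq [:: x, y & t].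
    by rewrite /= inE negb_or eq_sym yx xt yt ut.
  move=> /(_ s); rewrite s4 /= t3; suff h : {subset [:: x, y & t] <= s} by move=> /(_ h).
  by move=> z; rewrite !inE => /or3P[/eqP->|/eqP->|/tE[]].
- move=> [x [xs nSx Sy]].
  have remE y : (y \in rem x s) = (y != x) && (y \in s) by rewrite mem_rem_uniq.
  have -> : [set` s] `&` S = [set` rem x s].
    apply/seteqP; split=> y /=; rewrite remE.
      by move=> [-> Syy]; rewrite andbT; apply/eqP => yx; apply: nSx; rewrite -yx.
    by move=> /andP[yx ys]; split=> //; exact: Sy.
  have -> : 3%N = size (rem x s) by rewrite size_rem // s4.
  by apply: card_eq_seq; exact: rem_uniq.
Qed.

Lemma stable_rule_closed (Tri : set (set Z2)) (Q : set (seq Z2)) (S : set Z2) :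
  (forall s, Q s -> uniq s /\ size s = 4%N) ->
  (forall T, Tri T <-> exists2 s, Q s & T = [set` s]) ->
  (forall T, Tri T -> ~ (T `&` S #= `I_3)%card) <-> rule_closed Q S.
Proof.
move=> Qu TriQ; split.
- move=> stS s x Qs xs Sy; apply: contrapT => nSx.
  have [us s4] := Qu s Qs.
  apply: (stS [set` s]); first by apply/TriQ; exists s.
  by apply/card3_quad => //; exists x.
- move=> clS _ /TriQ[s Qs ->]; have [us s4] := Qu s Qs.
  by move=> /card3_quad[] // x [xs nSx Sy]; apply: nSx; exact: (clS s).
Qed.

Section Stability.
Variable R : realType.

Lemma lattice_points_hull3 (a b c : Z2) : area a b c != 0 ->
  lattice_points (hull3 (toplane R a) (toplane R b) (toplane R c)) =
  [set q | intri a b c q].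
Proof.
move=> D0; have DR : area (toplane R a) (toplane R b) (toplane R c) != 0.
  by rewrite area_toplane intr_eq0.
apply/seteqP; split=> q /=.
- by move=> /hull3P[] //; rewrite !area_toplane -!intrM !ler0z => ? ? ?; apply/and3P.
- move=> /and3P[h1 h2 h3]; apply/hull3P => //.
  by rewrite !area_toplane -!intrM !ler0z.
Qed.

Lemma interior_toplane (a b c q : Z2) : area a b c != 0 ->
  (hull3 (toplane R a) (toplane R b) (toplane R c))° (toplane R q) <->
  [/\ 0 < area q b c * area a b c, 0 < area a q c * area a b c &
      0 < area a b q * area a b c].
Proof.
move=> D0; have DR : area (toplane R a) (toplane R b) (toplane R c) != 0.
  by rewrite area_toplane intr_eq0.
by rewrite interior_hull3P // !area_toplane -!intrM !ltr0z.
Qed.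

(** [loc] stays abstract, so border and internal triangles share the passage from the real hull to
    the integer test [intri]. *)
Lemma minimal_triangleP (loc : set (R * R) -> set (R * R)) (T : set Z2) :
  minimal_triangle_with loc T <->
  exists a b c p : Z2, [/\ area a b c != 0, uniq [:: a; b; c; p],
    T = [set` [:: a; b; c; p]],
    forall q, intri a b c q = (q \in [:: a; b; c; p]) &
    loc (hull3 (toplane R a) (toplane R b) (toplane R c)) (toplane R p)].
Proof.
split.
- move=> [D [a [b [c [[/collinearP/eqP ncol DE] TE T4 [p [Tp npv locp]]]]]]].
  have D0 : area a b c != 0 by rewrite area_toplane intr_eq0 in ncol.
  have {}TE : T = [set q | intri a b c q] by rewrite TE DE lattice_points_hull3.
  have u3 : uniq [:: a; b; c].
    rewrite /= !inE negb_or andbT; apply/andP; split; first (apply/andP; split).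
    + by apply: contra_neq D0 => ->; rewrite /area; ring.
    + by apply: contra_neq D0 => ->; rewrite /area; ring.
    + by apply: contra_neq D0 => ->; rewrite /area; ring.
  have ps : p \notin [:: a; b; c].
    by rewrite !inE; apply/negP => /or3P[]/eqP pE; apply: npv;
      rewrite pE; [left; left|left; right|right].
  have u4 : uniq [:: a; b; c; p].
    rewrite -[[:: a; b; c; p]]/([:: a; b; c] ++ [:: p]) cat_uniq u3 /=.
    by rewrite orbF ps.
  have D2 : 0 <= area a b c * area a b c by rewrite -expr2 sqr_ge0.
  have sT : {in [:: a; b; c; p], forall y, T y}.
    move=> y; rewrite !inE => /or4P[]/eqP-> //; rewrite TE /= /intri.
    + have -> : area a a c = 0 by rewrite /area; ring.
      have -> : area a b a = 0 by rewrite /area; ring.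
      by rewrite mul0r D2 lexx.
    + have -> : area b b c = 0 by rewrite /area; ring.
      have -> : area a b b = 0 by rewrite /area; ring.
      by rewrite mul0r D2 lexx.
    + have -> : area c b c = 0 by rewrite /area; ring.
      have -> : area a c c = 0 by rewrite /area; ring.
      by rewrite mul0r D2 lexx.
  have TE' := @card_eq_seqE T [:: a; b; c; p] T4 u4 sT.
  exists a, b, c, p; split=> //; last by rewrite -DE.
  move=> q; apply/idP/idP.
  + move=> h; have : T q by rewrite TE.
    by rewrite TE'.
  + by move=> /sT; rewrite TE.
- move=> [a [b [c [p [D0 u4 TE inE' locp]]]]].
  exists (hull3 (toplane R a) (toplane R b) (toplane R c)), a, b, c; split.
  + by split=> // /collinearP/eqP; apply/negP; rewrite area_toplane intr_eq0.
  + by rewrite lattice_points_hull3 // TE; apply/seteqP; split=> q /=; rewrite inE'.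
  + by rewrite TE; exact: (card_eq_seq u4).
  + exists p; split=> //; first by rewrite TE /= !inE eqxx !orbT.
    move: u4; rewrite /= !inE !negb_or => /and4P[/and3P[_ _ ap] /andP[_ bp] cp _].
    by move=> [[]|] /eqP; rewrite eq_sym; apply/negP.
Qed.

(** The hull contains [p], so lying on the boundary means not being interior, that is, having a
    vanishing coordinate. *)
Lemma boundary_toplane (a b c p : Z2) : area a b c != 0 -> intri a b c p ->
  boundary (hull3 (toplane R a) (toplane R b) (toplane R c)) (toplane R p) <->
  [\/ area p b c = 0, area a p c = 0 | area a b p = 0].
Proof.
move=> D0 pin; have pD : hull3 (toplane R a) (toplane R b) (toplane R c) (toplane R p).
  by have := lattice_points_hull3 D0 => /(congr1 (fun A => A p)) /= hE;
    rewrite -[hull3 _ _ _ _]/(lattice_points _ p) hE.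
split.
- move=> [_ nint]; apply: contrapT => h.
  apply: nint; apply/interior_toplane => //.
  case/and3P: pin => h1 h2 h3.
  by split; rewrite lt_def ?h1 ?h2 ?h3 andbT mulf_neq0 //; apply/eqP => E;
    apply: h; [constructor 1|constructor 2|constructor 3].
- move=> h; split; first exact: subset_closure.
  move=> /interior_toplane[] // h1 h2 h3.
  by case: h => E; move: h1 h2 h3; rewrite E mul0r ltxx.
Qed.

Lemma set_mem_eq (s t : seq Z2) : s =i t -> [set` s] = [set` t].
Proof. by move=> st; apply/seteqP; split=> y /=; rewrite st. Qed.

Lemma border_triangleP (T : set Z2) :
  border_triangle R T <-> exists2 s, quads bquad s & T = [set` s].
Proof.
split.
- move=> /minimal_triangleP[a [b [c [p [D0 u4 -> inT locp]]]]].
  have pin : intri a b c p by rewrite inT !inE eqxx !orbT.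
  have pn : p \notin [:: a; b; c].
    by move: u4; rewrite /= !inE !negb_or ![_ == p]eq_sym
      => /and4P[/and3P[_ _ ->] /andP[_ ->] ->].
  suff [u [v [uv st]]] : exists u v, unimod u v /\ [:: a; b; c; p] =i bquad p u v.
    by exists (bquad p u v); [exists p, u, v|exact: set_mem_eq].
  have perm3 (x y z q w : Z2) :
      (q \in [:: y; z; x; w]) = (q \in [:: x; y; z; w]).
    by rewrite !inE; case: (q == x); case: (q == y); case: (q == z).
  (* The vertices are relabelled cyclically so that [p] lies on the side between the first two, as
     [border_form] expects. *)
  move/(boundary_toplane D0 pin): locp => [E|E|E].
  + have [|||||u [v [uv st]]] := @border_form b c a p.
    * by rewrite area_rot.
    * by move=> q; rewrite intri_rot inT (perm3 a b c).
    * by rewrite intri_rot.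
    * by move: pn; rewrite !inE !negb_or => /and3P[-> -> ->].
    * by rewrite area_rot.
    by exists u, v; split=> // q; rewrite -st (perm3 a b c).
  + have [|||||u [v [uv st]]] := @border_form c a b p.
    * by rewrite area_rot area_rot.
    * by move=> q; rewrite intri_rot intri_rot inT (perm3 b c a) (perm3 a b c).
    * by rewrite intri_rot intri_rot.
    * by move: pn; rewrite !inE !negb_or => /and3P[-> -> ->].
    * by rewrite area_rot area_rot.
    by exists u, v; split=> // q; rewrite -st (perm3 b c a) (perm3 a b c).
  + by apply: border_form => // q; rewrite inT.
- move=> [_ [p [u [v [uv ->]]]] TE]; apply/minimal_triangleP.
  have D0 : area (p + u) (p - u) (p + v) != 0.
    rewrite (_ : area _ _ _ = - 2 * det u v); last by rewrite /area /det /=; ring.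
    by case/unimodP: uv => ->.
  have st : [:: p + u; p - u; p + v; p] =i bquad p u v.
    by move=> q; rewrite !inE orbC -!orbA; do !bool_congr.
  exists (p + u), (p - u), (p + v), p; split=> //.
  + by rewrite -[X in uniq X]/(rot 1 (bquad p u v)) rot_uniq; exact: bquad_uniq.
  + by rewrite TE; exact/esym/set_mem_eq.
  + by move=> q; rewrite intri_bquad // st.
  + apply/boundary_toplane => //; first by rewrite intri_bquad // inE eqxx.
    by constructor 3; rewrite /area /=; ring.
Qed.

Lemma internal_triangleP (T : set Z2) :
  internal_triangle R T <-> exists2 s, quads iquad s & T = [set` s].
Proof.
split.
- move=> /minimal_triangleP[a [b [c [p [D0 u4 -> inT locp]]]]].
  have pin : intri a b c p by rewrite inT !inE eqxx !orbT.
  have pn : p \notin [:: a; b; c].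
    by move: u4; rewrite /= !inE !negb_or ![_ == p]eq_sym
      => /and4P[/and3P[_ _ ->] /andP[_ ->] ->].
  have pos0 (x : int) : 0 < x * area a b c -> x != 0.
    by apply: contraTneq => ->; rewrite mul0r ltxx.
  move/(interior_toplane p D0): locp => [/pos0 h1 /pos0 h2 /pos0 h3].
  have [q|u [v [uv st]]] := internal_form D0 _ pin pn h1 h2 h3; first by rewrite inT.
  by exists (iquad p u v); [exists p, u, v|exact: set_mem_eq].
- move=> [_ [p [u [v [uv ->]]]] TE]; apply/minimal_triangleP.
  have DE : area (p + u) (p + v) (p - u - v) = 3 * det u v.
    by rewrite /area /det /=; ring.
  have D0 : area (p + u) (p + v) (p - u - v) != 0.
    by rewrite DE; case/unimodP: uv => ->.
  have st : [:: p + u; p + v; p - u - v; p] =i iquad p u v.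
    by move=> q; rewrite !inE orbC -!orbA; do !bool_congr.
  exists (p + u), (p + v), (p - u - v), p; split=> //.
  + by rewrite -[X in uniq X]/(rot 1 (iquad p u v)) rot_uniq; exact: iquad_uniq.
  + by rewrite TE; exact/esym/set_mem_eq.
  + by move=> q; rewrite intri_iquad // st.
  + apply/interior_toplane => //; rewrite DE.
    have e := unimod_sqr uv; split.
    * rewrite [X in 0 < X](_ : _ = 3 * (det u v * det u v)).
        by rewrite e mulr1.
      by rewrite /area /det /=; ring.
    * rewrite [X in 0 < X](_ : _ = 3 * (det u v * det u v)).
        by rewrite e mulr1.
      by rewrite /area /det /=; ring.
    * rewrite [X in 0 < X](_ : _ = 3 * (det u v * det u v)).
        by rewrite e mulr1.
      by rewrite /area /det /=; ring.
Qed.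

Lemma B_stableP (S : set Z2) : B_stable R S <-> rule_closed (quads bquad) S.
Proof.
apply: stable_rule_closed => [_ [p [u [v [uv ->]]]]|T]; last exact: border_triangleP.
by split=> //; exact: bquad_uniq.
Qed.

Lemma I_stableP (S : set Z2) : I_stable R S <-> rule_closed (quads iquad) S.
Proof.
apply: stable_rule_closed => [_ [p [u [v [uv ->]]]]|T]; last exact: internal_triangleP.
by split=> //; exact: iquad_uniq.
Qed.

Lemma BI_stableP (S : set Z2) :
  BI_stable R S <-> rule_closed (quads bquad `|` quads iquad) S.
Proof.
rewrite /BI_stable B_stableP I_stableP; split=> [[clB clI] s x|clS].
  by case; [exact: clB|exact: clI].
by split=> s x Qs; apply: clS; [left|right].
Qed.

Lemma maximal_set_ext (st st' : set Z2 -> Prop) (S : set Z2) :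
  (forall A, st A <-> st' A) -> maximal_set st S -> maximal_set st' S.
Proof.
move=> E [stS ST max]; split=> //; first exact/E.
by move=> A /E; exact: max.
Qed.

End Stability.

(** * Subsets of stable sets, and the theorem *)

Lemma bclosed_subset (S S' : set Z2) : rule_closed (quads bquad) S ->
  S `<` setT -> S' `<=` S -> rule_closed (quads bquad) S'.
Proof.
move=> clS /proper_setT ST sub s x [p [u [v [uv ->]]]] xs Sy; exfalso.
(* Three points of a quadruple in [S'] put the whole quadruple in [S], which is then everything.
   Hence the premise of the rule never holds for [S']. *)
apply: ST; have Ss : {in bquad p u v, forall y, S y}.
  move=> y ys; have [->|yx] := eqVneq y x; last exact/sub/Sy.
  by apply: (clS (bquad p u v)) => // [|z zs zx]; [exists p, u, v|exact/sub/Sy].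
by apply: (@bclosed_setT S p u v clS uv); apply: Ss; rewrite !inE eqxx ?orbT.
Qed.

Lemma biclosed_subset (S S' : set Z2) :
  rule_closed (quads bquad `|` quads iquad) S -> S `<` setT -> S' `<=` S ->
  rule_closed (quads bquad `|` quads iquad) S'.
Proof.
move=> clS ST sub s x [Bs|].
  apply: (@bclosed_subset S) => //.
  by move=> t y Bt; apply: clS; left.
move=> [p [u [v [uv ->]]]] xs Sy; exfalso; move/proper_setT: ST; apply.
have Ss : {in iquad p u v, forall y, S y}.
  move=> y ys; have [->|yx] := eqVneq y x; last exact/sub/Sy.
  apply: (clS (iquad p u v)) => // [|z zs zx]; last exact/sub/Sy.
  by right; exists p, u, v.
(* The internal quadruple already contains the unimodular triangle [p], [p + u], [p + v]. *)
apply: (@bclosed_setT S p u v) => //; try by apply: Ss; rewrite !inE eqxx ?orbT.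
by move=> t y Bt; apply: clS; left.
Qed.

(** As for border triangles, except that a full internal quadruple in [S] leads through
    [iclosed_internal] to one of the excluded images. *)
Lemma iclosed_subset (S S' : set Z2) : rule_closed (quads iquad) S ->
  ~ (unimodular_image J_quarter S \/ unimodular_image J_half S \/
     unimodular_image setT S) ->
  S' `<=` S -> rule_closed (quads iquad) S'.
Proof.
move=> clS nJ sub s x [p [u [v [uv ->]]]] xs Sy; exfalso; apply: nJ.
apply: (@iclosed_internal S p u v clS uv) => y ys.
have [->|yx] := eqVneq y x; last exact/sub/Sy.
by apply: (clS (iquad p u v)) => // [|z zs zx]; [exists p, u, v|exact/sub/Sy].
Qed.

Lemma biclosed_generators (S : set Z2) :
  rule_closed (quads bquad `|` quads iquad) S ->
  {in generators, forall y, S y} -> S = setT.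
Proof.
by move=> clS; apply: bclosed_generators => s x Bs; apply: clS; left.
Qed.

Unset Implicit Arguments.

Theorem theorem1p4 (R : realType) :
  (* (a) *)
  ((forall S S' : set Z2, B_stable R S -> S `<` setT -> S' `<=` S ->
      B_stable R S') /\
   (forall S S' : set Z2, BI_stable R S -> S `<` setT -> S' `<=` S ->
      BI_stable R S')) /\
  (* (b) *)
  (forall S S' : set Z2, I_stable R S ->
     ~ (unimodular_image J_quarter S \/ unimodular_image J_half S \/
        unimodular_image setT S) ->
     S' `<=` S -> I_stable R S') /\
  (* (c) *)
  ((forall S : set Z2, B_stable R S -> S `<` setT ->
      exists2 S', maximal_set (B_stable R) S' & S `<=` S') /\
   (forall S : set Z2, I_stable R S -> S `<` setT ->
      exists2 S', maximal_set (I_stable R) S' & S `<=` S') /\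
   (forall S : set Z2, BI_stable R S -> S `<` setT ->
      exists2 S', maximal_set (BI_stable R) S' & S `<=` S')) /\
  (* (d) *)
  ((exists2 S, maximal_set (B_stable R) S & ~ periodic_set S) /\
   (exists2 S, maximal_set (I_stable R) S & ~ periodic_set S) /\
   (exists2 S, maximal_set (BI_stable R) S & ~ periodic_set S)).
Proof.
have maxE st Q S : (forall A, st A <-> rule_closed Q A) ->
    maximal_set (rule_closed Q) S -> maximal_set st S.
  by move=> E; apply: maximal_set_ext => A; split=> /E.
have Bmax S := @maxE _ _ S (@B_stableP R).
have Imax S := @maxE _ _ S (@I_stableP R).
have BImax S := @maxE _ _ S (@BI_stableP R).
split; last split; last split.
- split=> S S'.
  + by move=> /B_stableP clS ST sub; apply/B_stableP; exact: bclosed_subset sub.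
  + by move=> /BI_stableP clS ST sub; apply/BI_stableP; exact: biclosed_subset sub.
- by move=> S S' /I_stableP clS nJ sub; apply/I_stableP; exact: iclosed_subset sub.
- split; last split.
  + move=> S /B_stableP clS ST.
    have [S' /Bmax] := exists_maximal_closed bclosed_generators clS ST.
    by exists S'.
  + move=> S /I_stableP clS ST.
    have [S' /Imax] := exists_maximal_closed iclosed_generators clS ST.
    by exists S'.
  + move=> S /BI_stableP clS ST.
    have [S' /BImax] := exists_maximal_closed biclosed_generators clS ST.
    by exists S'.
- split; last split.
  + have [S /Bmax] := exists_nonperiodic_maximal (@subsetUl _ _ _) bclosed_generators.
    by exists S.
  + have [S /Imax] := exists_nonperiodic_maximal (@subsetUr _ _ _) iclosed_generators.
    by exists S.
  + have [S /BImax] := exists_nonperiodic_maximal (@subset_refl _ _) biclosed_generators.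
    by exists S.
Qed.
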